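(* Let $\mathcal{C}=\langle E,c,\{\mathcal{R}_i\}_{i=1}^n\rangle$ be a covering problem, $\lambda\ge1$, and let $\Omega=\mathcal{M}\cap\mathcal{K}$ where $\mathcal{M}\subseteq2^{[n]}$ is a $p$-system (given by a membership oracle) and $\mathcal{K}$ is a $q$-knapsack family. Suppose there is a polynomial-time $\alpha_{off}$-approximation algorithm for the augmentation problem of $\mathcal{C}$ and a polynomial-time deterministic $\alpha_{on}$-competitive online algorithm for $\mathcal{C}$. Then the robust covering problem $\langle E,c,\{\mathcal{R}_i\}_{i=1}^n,\Omega,\lambda\rangle$ admits an $O((p+1)(q+1)\,\alpha_{off}\,\alpha_{on})$-approximation algorithm.
   Context: A covering problem $\mathcal{C}=\langle E,c,\{\mathcal{R}_i\}_{i=1}^n\rangle$ has a finite ground set $E$ with costs $c:E\to\mathbb{R}_{\ge0}$ ($c(F)=\sum_{e\in F}c_e$) and requirements $i\in[n]$, each given by an upward-closed family $\mathcal{R}_i\subseteq2^E$; $F$ satisfies $i$ iff $F\in\mathcal{R}_i$. For $S\subseteq E$, $X\subseteq[n]$: $\mathrm{Opt}_{aug}(X\mid S)=\min\{c(A):A\subseteq E,\ S\cup A\in\mathcal{R}_i\ \forall i\in X\}$, $\mathrm{Opt}(X)=\mathrm{Opt}_{aug}(X\mid\emptyset)$. An $\alpha_{off}$-approximation algorithm for the augmentation problem, given $S,X$, outputs $A$ with $S\cup A\in\mathcal{R}_i$ for all $i\in X$ and $c(A)\le\alpha_{off}\mathrm{Opt}_{aug}(X\mid S)$. In the online version, requirements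 arrive one by one in a sequence $\sigma$; a deterministic online algorithm $\mathcal{A}_{on}$ maintains $\mathcal{A}_{on}(\sigma)\subseteq E$ satisfying all arrived requirements, only adding elements; it is $\alpha_{on}$-competitive if $c(\mathcal{A}_{on}(\sigma))\le\alpha_{on}\mathrm{Opt}(\text{requirements in }\sigma)$ for all $\sigma$. A $p$-system is a downward-closed $\mathcal{M}\subseteq2^{[n]}$ such that for every $A\subseteq[n]$ any two inclusion-maximal members of $\mathcal{M}$ contained in $A$ have sizes within factor $p$. A $q$-knapsack family is $\{A\subseteq[n]:\sum_{e\in A}w^j(e)\le b_j\ \forall j\in[q]\}$ for nonnegative weights $w^j:[n]\to\mathbb{R}_{\ge0}$ and capacities $b_j$. Robust covering problem $\langle E,c,\{\mathcal{R}_i\},\Omega,\lambda\rangle$: a solution is a first-stage set $E_0\subseteq E$ plus an augmentation procedure giving for each $\omega\in\Omega$ a set $E_\omega\subseteq E$ with $E_0\cup E_\omega\in\mathcal{R}_i$ for all $i\in\omega$; minimize $c(E_0)+\lambda\max_{\omega\in\Omega}c(E_\omega)$. A $\rho$-approximation algorithm outputs a solution of objective at most $\rho$ times optimal. *)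

(* Defs.v *)
From mathcomp Require Import all_boot all_order all_algebra.
From mathcomp Require Import reals.

Set Implicit Arguments.
Unset Strict Implicit.
Unset Printing Implicit Defensive.

Import Order.TTheory GRing.Theory Num.Theory.
Local Open Scope ring_scope.

Record covering (R : realType) := Covering {
  nelt : nat;
  nreq : nat;
  cost : 'I_nelt -> R;
  req : 'I_nreq -> {set {set 'I_nelt}};
  cost_ge0 : forall e, 0 <= cost e;
  req_up : forall i (F G : {set 'I_nelt}),
    F \in req i -> F \subset G -> G \in req i }.

Section Covering.
Variables (R : realType) (C : covering R).
Implicit Types (F S A : {set 'I_(nelt C)}) (X : {set 'I_(nreq C)}).

Definition set_cost F : R := \sum_(e in F) cost e.

Definition satisfies F X : bool := [forall i in X, F \in req i].

(* By upward closure, whenever some A is feasible so is the whole ground set;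
   the default value of the minimum is its cost, hence does not affect the
   minimum.  Requirements that no set satisfies are excluded by the existence
   of an offline algorithm. *)
Definition opt_aug X S : R :=
  \big[Order.min/set_cost setT]_(A | satisfies (S :|: A) X) set_cost A.

Definition opt X : R := opt_aug X set0.

Implicit Types (Omega : {set {set 'I_(nreq C)}}) (lam : R)
  (Ew : {ffun {set 'I_(nreq C)} -> {set 'I_(nelt C)}}).

Definition robust_feasible Omega (E0 : {set 'I_(nelt C)}) Ew : bool :=
  [forall w in Omega, satisfies (E0 :|: Ew w) w].

(* Costs are nonnegative, so the default value 0 only matters for an empty
   uncertainty set. *)
Definition robust_value Omega lam (E0 : {set 'I_(nelt C)}) Ew : R :=
  set_cost E0 + lam * \big[Order.max/0]_(w in Omega) set_cost (Ew w).

(* The default value is that of buying everything in the first stage. *)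
Definition robust_opt Omega lam : R :=
  \big[Order.min/set_cost setT]_
      (s : {set 'I_(nelt C)} *
           {ffun {set 'I_(nreq C)} -> {set 'I_(nelt C)}}
       | robust_feasible Omega s.1 s.2) robust_value Omega lam s.1 s.2.

End Covering.

Definition p_system (R : realType) (n : nat) (p : R)
    (M : {set {set 'I_n}}) : Prop :=
  (forall A B : {set 'I_n}, A \in M -> B \subset A -> B \in M) /\
  (forall A B1 B2 : {set 'I_n},
     maxset (fun B => (B \in M) && (B \subset A)) B1 ->
     maxset (fun B => (B \in M) && (B \subset A)) B2 ->
     #|B1|%:R <= p * #|B2|%:R).

Definition knapsacks (R : realType) (n q : nat) (w : 'I_q -> 'I_n -> R)
    (b : 'I_q -> R) : {set {set 'I_n}} :=
  [set A : {set 'I_n} | [forall j, \sum_(i in A) w j i <= b j]].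

(* Programs of a WHILE language over binary trees whose leaves are [Nil] or
   real numbers.  Every elementary operation, including exact real arithmetic
   and comparison and a query to the oracle, has unit cost (the real-RAM /
   Blum-Shub-Smale convention).  Programs are finite syntax with no numeric
   constant but 1, so a program is one uniform algorithm for all inputs.
   Operations are total: projections of a leaf give [Nil], a non-number is read
   as 0 by arithmetic, and division by 0 gives 0. *)

Inductive data (R : realType) :=
  | Nil
  | Num of R
  | Cons of data R & data R.
Arguments Nil {R}.

Inductive basic :=
  | BId | BFst | BSnd | BNil | BOne
  | BAdd | BSub | BMul | BDiv | BLeq | BIsNum | BQuery.

Inductive prog :=
  | Basic of basic
  | Seq of prog & prog
  | Pair of prog & prog
  | If of prog & prog & prog
  | While of prog & prog.

Section Semantics.
Variable R : realType.
Implicit Types u v x y : data R.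

Definition truthy v : bool := if v is Nil then false else true.

Definition enc_bool (b : bool) : data R := if b then Cons Nil Nil else Nil.

Definition fst_data v := if v is Cons x _ then x else Nil.
Definition snd_data v := if v is Cons _ y then y else Nil.
Definition num_data v : R := if v is Num r then r else 0.

Definition basic_sem (O : data R -> bool) (o : basic) v : data R :=
  let a := num_data (fst_data v) in
  let b := num_data (snd_data v) in
  match o with
  | BId => v
  | BFst => fst_data v
  | BSnd => snd_data v
  | BNil => Nil
  | BOne => Num 1
  | BAdd => Num (a + b)
  | BSub => Num (a - b)
  | BMul => Num (a * b)
  | BDiv => Num (a / b)
  | BLeq => enc_bool (a <= b)
  | BIsNum => enc_bool (if v is Num _ then true else false)
  | BQuery => enc_bool (O v)
  end.

(* [run O P v y t]: with oracle [O], program [P] halts on input [v] after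
   exactly [t] steps with output [y]. *)
Inductive run (O : data R -> bool) :
    prog -> data R -> data R -> nat -> Prop :=
  | RunBasic o v : run O (Basic o) v (basic_sem O o v) 1
  | RunSeq P Q v u y s t :
      run O P v u s -> run O Q u y t -> run O (Seq P Q) v y (s + t).+1
  | RunPair P Q v x y s t :
      run O P v x s -> run O Q v y t -> run O (Pair P Q) v (Cons x y) (s + t).+1
  | RunIf T P Q v u y s t :
      run O T v u s -> run O (if truthy u then P else Q) v y t ->
      run O (If T P Q) v y (s + t).+1
  | RunWhileStop T P v u s :
      run O T v u s -> ~~ truthy u -> run O (While T P) v v s.+1
  | RunWhileStep T P v u v' y s s' t :
      run O T v u s -> truthy u -> run O P v v' s' -> run O (While T P) v' y t ->
      run O (While T P) v y (s + s' + t).+1.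

Definition no_oracle : data R -> bool := fun _ => false.

Fixpoint data_size v : nat :=
  if v is Cons x y then (data_size x + data_size y).+1 else 1.

(* Polynomial running time is: one [k] for all inputs. *)
Definition computes (O : data R -> bool) (k : nat) (P : prog) v y : Prop :=
  exists2 t, run O P v y t & (t <= k * data_size v ^ k)%N.

Definition enc_seq (s : seq (data R)) : data R := foldr (@Cons R) Nil s.

Definition enc_nat (k : nat) : data R := enc_seq (nseq k Nil).

Definition enc_set (n : nat) (A : {set 'I_n}) : data R :=
  enc_seq [seq enc_bool (i \in A) | i <- enum 'I_n].

Definition enc_vec (n : nat) (f : 'I_n -> R) : data R :=
  enc_seq [seq Num (f i) | i <- enum 'I_n].

(* The families R_i may have exponential size, so algorithms get them only
   through an arbitrary problem-specific description (e.g. a graph with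
   terminal pairs).  A computational covering problem is a class
   [P : instance R -> Prop]. *)
Record instance := Instance {
  inst_cov :> covering R;
  inst_descr : data R }.

Definition enc_inst (I : instance) : data R :=
  Cons (enc_vec (@cost R I)) (Cons (enc_nat (nreq I)) (inst_descr I)).

Definition enc_robust (I : instance) (q : nat) (w : 'I_q -> 'I_(nreq I) -> R)
    (b : 'I_q -> R) (lam : R) : data R :=
  Cons (enc_inst I)
    (Cons (enc_seq [seq Cons (Num (b j)) (enc_vec (w j)) | j <- enum 'I_q])
          (Num lam)).

Definition offline_approx_algorithm (P : instance -> Prop)
    (alpha : instance -> R) (Aoff : prog) : Prop :=
  exists k : nat, forall I : instance, P I ->
  forall (S : {set 'I_(nelt I)}) (X : {set 'I_(nreq I)}),
  exists A : {set 'I_(nelt I)},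
  [/\ computes no_oracle k Aoff
        (Cons (enc_inst I) (Cons (enc_set S) (enc_set X))) (enc_set A),
      satisfies (S :|: A) X
    & set_cost A <= alpha I * opt_aug X S].

Definition online_algorithm (P : instance -> Prop)
    (alpha : instance -> R) (Aon : prog) : Prop :=
  exists k : nat, forall I : instance, P I ->
  exists f : seq 'I_(nreq I) -> {set 'I_(nelt I)},
  [/\ forall sigma : seq 'I_(nreq I), computes no_oracle k Aon
        (Cons (enc_inst I) (enc_seq [seq enc_nat (nat_of_ord i) | i <- sigma]))
        (enc_set (f sigma)),
      forall sigma : seq 'I_(nreq I), satisfies (f sigma) [set i in sigma],
      forall (sigma : seq 'I_(nreq I)) (i : 'I_(nreq I)),
        f sigma \subset f (rcons sigma i)
    & forall sigma : seq 'I_(nreq I),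
        set_cost (f sigma) <= alpha I * opt [set i in sigma]].

Definition membership_oracle (n : nat) (M : {set {set 'I_n}})
    (O : data R -> bool) : Prop :=
  forall A : {set 'I_n}, O (enc_set A) = (A \in M).

(* The algorithm consists of a program [first] for the first-stage set and a
   program [second], the augmentation procedure, for the second-stage sets.
   Neither is given p or the ratios, and the single exponent [k] bounds the
   running time for all p and q. *)
Definition robust_approx_algorithm (P : instance -> Prop)
    (rho : instance -> R -> nat -> R) (first second : prog) : Prop :=
  exists k : nat, forall I : instance, P I ->
  forall (p : R) (M : {set {set 'I_(nreq I)}}) (q : nat)
    (w : 'I_q -> 'I_(nreq I) -> R) (b : 'I_q -> R) (lam : R),
  p_system p M -> (forall j i, 0 <= w j i) -> 1 <= lam ->
  forall O : data R -> bool, membership_oracle M O ->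
  let Omega := M :&: knapsacks w b in
  let input := enc_robust w b lam in
  exists (E0 : {set 'I_(nelt I)})
    (Ew : {ffun {set 'I_(nreq I)} -> {set 'I_(nelt I)}}),
  [/\ computes O k first input (enc_set E0),
      forall om : {set 'I_(nreq I)}, om \in Omega ->
        computes O k second
          (Cons input (Cons (enc_set E0) (enc_set om))) (enc_set (Ew om)),
      robust_feasible Omega E0 Ew
    & robust_value Omega lam E0 Ew <= rho I p q * robust_opt Omega lam].

End Semantics.

(* Main.v *)
From mathcomp Require Import all_boot all_order all_algebra.
From mathcomp Require Import boolp reals.
From mathcomp Require Import zify ring lra.
(* Imported last: [seq] also exports a [Cons]. *)
Require Import Defs.
Set Implicit Arguments.
Unset Strict Implicit.
Unset Printing Implicit Defensive.
Import Order.TTheory GRing.Theory Num.Theory.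
Local Open Scope ring_scope.

(* Fix a threshold theta.  A phase extends the request sequence greedily: among
   the requirements that keep the set added in this phase in the p-system, and
   whose online cost increment is at least theta/q times their normalized
   knapsack weight, it requests one of largest increment.  A phase of total
   increment more than theta is kept, otherwise the process stops and the online
   solution is the first stage.  At the stop, charging every requirement of a
   scenario to the greedy requests that block it bounds the augmentation cost
   by (p + 2) theta.  The requests of a kept phase have normalized weight at most
   2q, so they are covered by 4q + 1 scenarios; competitiveness against the
   optimal robust solution then bounds the number of kept phases, as soon as
   theta >= 2 (4q + 1) alpha_on T with T the optimal second-stage cost.  Neither
   p nor the ratios need to be known: a suitable theta exists among the multiples
   i * cost e with i <= |E|, and the algorithm minimizes c(E_0) + lambda * theta
   over these. *)

(** * Polynomial-time evaluation of families of inputs *)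

(** Three obstacles shape the development. (1) The knapsacks enter a phase through one load cap [q]
    on normalized weight, tested before each addition: the load stays at most [2 * q], and a load
    above [q] forces, by the density test, an increment above [theta]. So in the last, small phase
    the cap never rejects a request: those of a scenario that remain are blocked by the p-system, of
    low density or of nonpositive increment. (2) The second-stage cost [T] is an unknown real, and
    guessing it by doubling takes a number of rounds that depends on the ratios of the costs, not
    only on how many numbers are given. Increments are costs of sets, however, and the gaps between
    such costs leave polynomially many relevant thresholds. (3) One polynomial has to bound the
    program on all inputs, although it calls the online algorithm on sequences that it builds
    itself. Only requests of positive increment are made, each of them enlarges the online solution,
    and so a sequence has at most |E| entries. *)

Section Runs.
Variable R : realType.
Implicit Types (O : data R -> bool) (v y : data R).

(* The given algorithms run without an oracle, where a query answers [Nil]. *)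
Fixpoint strip_queries (P : prog) : prog :=
  match P with
  | Basic BQuery => Basic BNil
  | Basic o => Basic o
  | Seq P Q => Seq (strip_queries P) (strip_queries Q)
  | Pair P Q => Pair (strip_queries P) (strip_queries Q)
  | If T P Q => If (strip_queries T) (strip_queries P) (strip_queries Q)
  | While T P => While (strip_queries T) (strip_queries P)
  end.

Lemma run_strip_queries O P v y t :
  run (@no_oracle R) P v y t -> run O (strip_queries P) v y t.
Proof.
elim=> {P v y t} /=.
- by case=> v; apply: RunBasic.
- by move=> *; apply: RunSeq; eassumption.
- by move=> *; apply: RunPair.
- move=> T P Q v u y s t _ hT _; case: ifP => hu hP;
    by apply: RunIf; [exact: hT | rewrite hu].
- by move=> *; apply: RunWhileStop; eassumption.
- by move=> *; apply: RunWhileStep; eassumption.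
Qed.

Definition runs O P v y (T : nat) : Prop := exists2 t, run O P v y t & (t <= T)%N.

Lemma runs_le O P v y T T' : runs O P v y T -> (T <= T')%N -> runs O P v y T'.
Proof. by case=> t h ht hT; exists t => //; apply: leq_trans hT. Qed.

Lemma runs_basic O o v : runs O (Basic o) v (basic_sem O o v) 1.
Proof. by exists 1%N => //; apply: RunBasic. Qed.

Lemma runs_seq O P Q v u y s t :
  runs O P v u s -> runs O Q u y t -> runs O (Seq P Q) v y (s + t).+1.
Proof.
case=> s' hs ls [t' ht lt]; exists (s' + t').+1; first exact: RunSeq hs ht.
by rewrite ltnS leq_add.
Qed.

Lemma runs_pair O P Q v x y s t :
  runs O P v x s -> runs O Q v y t -> runs O (Pair P Q) v (Cons x y) (s + t).+1.
Proof.
case=> s' hs ls [t' ht lt]; exists (s' + t').+1; first exact: RunPair hs ht.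
by rewrite ltnS leq_add.
Qed.

Lemma runs_if O T P Q v u y s t :
  runs O T v u s -> runs O (if truthy u then P else Q) v y t ->
  runs O (If T P Q) v y (s + t).+1.
Proof.
case=> s' hs ls [t' ht lt]; exists (s' + t').+1; first exact: RunIf hs ht.
by rewrite ltnS leq_add.
Qed.

(* Expressions are evaluated in an environment that is a list of values;
   [Fold l a body] runs [body] in the environment extended with the current
   element (variable 0) and the accumulator (variable 1). *)
Fixpoint Var (i : nat) : prog :=
  if i is i'.+1 then Seq (Basic BSnd) (Var i') else Basic BFst.
Definition Fst e := Seq e (Basic BFst).
Definition Snd e := Seq e (Basic BSnd).
Definition Op o a b := Seq (Pair a b) (Basic o).
Definition LetIn a e := Seq (Pair a (Basic BId)) e.
Definition Tup (s : seq prog) : prog := foldr Pair (Basic BNil) s.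
Definition True_ := Pair (Basic BNil) (Basic BNil).
Definition And a b := If a b (Basic BNil).
Definition Fold el ei eb :=
  Seq (Pair el (Pair ei (Basic BId)))
    (Seq (While (Basic BFst)
            (Pair (Seq (Basic BFst) (Basic BSnd))
               (Pair (Seq (Pair (Seq (Basic BFst) (Basic BFst)) (Basic BSnd)) eb)
                     (Seq (Basic BSnd) (Basic BSnd)))))
         (Seq (Basic BSnd) (Basic BFst))).

Lemma runs_fold O el ei eb env (l : seq (data R)) (a : nat -> data R) T1 T2 T :
  runs O el env (enc_seq l) T1 -> runs O ei env (a 0%N) T2 ->
  (forall t, (t < size l)%N ->
     runs O eb (Cons (nth Nil l t) (Cons (a t) env)) (a t.+1) T) ->
  runs O (Fold el ei eb) env (a (size l))
    (T1 + T2 + size l * (T + 20) + 20)%N.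
Proof.
move=> hl ha hb.
rewrite /Fold; set W := While _ _.
(* Loop state: the entries still to process, the accumulator after the prefix [l1], the environment.
   The 20 steps per round pay for projections and pairing. *)
have loop : forall l1 l2, l = l1 ++ l2 ->
    runs O W (Cons (enc_seq l2) (Cons (a (size l1)) env))
      (Cons Nil (Cons (a (size l)) env)) (size l2 * (T + 20) + 2)%N.
  move=> l1 l2; elim: l2 l1 => [|x l2 IH] l1 def_l.
    rewrite cats0 in def_l; subst l1.
    by exists 2%N => //; apply: (RunWhileStop _ (RunBasic O BFst _)).
  have sl : (size l1 < size l)%N by rewrite def_l size_cat /= addnS ltnS leq_addr.
  have [t ht lt] := IH (rcons l1 x) ltac:(by rewrite cat_rcons).
  have := hb _ sl.
  rewrite {1}def_l nth_cat ltnn subnn /= => -[s hs ls].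
  rewrite size_rcons in ht.
  eexists.
    apply: RunWhileStep ht; first exact: RunBasic.
      by [].
    apply: RunPair; first by apply: RunSeq; apply: RunBasic.
    apply: RunPair; last by apply: RunSeq; apply: RunBasic.
    apply: RunSeq hs.
    by apply: RunPair; [apply: RunSeq|]; apply: RunBasic.
  move: lt ls; rewrite /= mulSn; lia.
have := runs_seq (runs_pair hl (runs_pair ha (runs_basic O BId env)))
          (runs_seq (loop [::] l erefl)
             (runs_seq (runs_basic O BSnd _) (runs_basic O BFst _))).
by move/runs_le; apply; lia.
Qed.

End Runs.

Section Families.
Variable R : realType.

(** Polynomial time means one exponent for all inputs, so a program is analysed on a whole family at
    once. An index stands for an input with its oracle, and [sz] is the quantity in which bounds are
    polynomial; positive sizes let constants be absorbed into [k * sz j ^ k]. *)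
Record ctx := Ctx {
  idx :> Type;
  dom : idx -> Prop;
  sz : idx -> nat;
  orc : idx -> data R -> bool;
  sz_gt0 : forall j, (0 < sz j)%N }.
Implicit Types c : ctx.

Definition pbd c (g : c -> nat) : Prop :=
  exists k, forall j, dom j -> (g j <= k * sz j ^ k)%N.

Lemma pbd_le c (g h : c -> nat) :
  pbd h -> (forall j, dom j -> (g j <= h j)%N) -> pbd g.
Proof. by case=> k hk gh; exists k => j dj; apply: leq_trans (gh j dj) (hk j dj). Qed.

Lemma pbd_const c k : pbd (fun _ : c => k).
Proof.
by exists k => j _; rewrite leq_pmulr // expn_gt0 sz_gt0.
Qed.

Lemma pbd_sz c : pbd (fun j : c => sz j).
Proof. by exists 1%N => j _; rewrite mul1n expn1. Qed.

Lemma pbd_add c (g h : c -> nat) : pbd g -> pbd h -> pbd (fun j => g j + h j)%N.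
Proof.
case=> k hk [l hl]; exists (k + l)%N => j dj; rewrite mulnDl.
apply: leq_add; [apply: leq_trans (hk j dj) _ | apply: leq_trans (hl j dj) _];
  rewrite leq_mul2l leq_pexp2l ?sz_gt0 ?orbT //; lia.
Qed.

Lemma pbd_mul c (g h : c -> nat) : pbd g -> pbd h -> pbd (fun j => g j * h j)%N.
Proof.
case=> k hk [l hl]; exists (k * l + k + l)%N => j dj.
apply: leq_trans (leq_mul (hk j dj) (hl j dj)) _.
rewrite mulnACA -expnD; apply: leq_mul; first lia.
by rewrite leq_pexp2l ?sz_gt0 //; lia.
Qed.

Lemma pbd_exp c (g : c -> nat) k : pbd g -> pbd (fun j => g j ^ k)%N.
Proof.
move=> hg; elim: k => [|k IH]; first exact: pbd_const.
apply: (pbd_le (pbd_mul hg IH)) => j _; by rewrite expnS.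
Qed.

(* One polynomial bounds the running time over the whole family [c]. *)
Definition pev c (e : prog) (env out : c -> data R) : Prop :=
  exists2 g : c -> nat, pbd g &
    forall j, dom j -> runs (@orc c j) e (env j) (out j) (g j).

Lemma pev_ext c e (env out out' : c -> data R) :
  pev e env out -> (forall j, dom j -> out j = out' j) -> pev e env out'.
Proof. by case=> g hg h eo; exists g => // j dj; rewrite -eo //; apply: h. Qed.

Lemma pev_basic c o (env : c -> data R) :
  pev (Basic o) env (fun j => basic_sem (@orc c j) o (env j)).
Proof. by exists (fun=> 1%N); [exact: pbd_const | move=> j _; exact: runs_basic]. Qed.

Lemma pev_seq c P Q (v u y : c -> data R) : pev P v u -> pev Q u y -> pev (Seq P Q) v y.
Proof.
case=> g hg h [g' hg' h']; exists (fun j => (g j + g' j).+1).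
  by apply: (pbd_le (pbd_add (pbd_add hg hg') (pbd_const c 1))) => j _; rewrite addn1.
by move=> j dj; apply: runs_seq (h j dj) (h' j dj).
Qed.

Lemma pev_pair c P Q (v x y : c -> data R) :
  pev P v x -> pev Q v y -> pev (Pair P Q) v (fun j => Cons (x j) (y j)).
Proof.
case=> g hg h [g' hg' h']; exists (fun j => (g j + g' j).+1).
  by apply: (pbd_le (pbd_add (pbd_add hg hg') (pbd_const c 1))) => j _; rewrite addn1.
by move=> j dj; apply: runs_pair (h j dj) (h' j dj).
Qed.

Lemma pev_if c T P Q (v u x y : c -> data R) :
  pev T v u -> pev P v x -> pev Q v y ->
  pev (If T P Q) v (fun j => if truthy (u j) then x j else y j).
Proof.
case=> g hg h [g1 hg1 h1] [g2 hg2 h2]; exists (fun j => (g j + (g1 j + g2 j)).+1).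
  apply: (pbd_le (pbd_add (pbd_add hg (pbd_add hg1 hg2)) (pbd_const c 1))) => j _.
  by rewrite addn1.
move=> j dj; apply: runs_if (h j dj) _; case: ifP => _.
  by apply: runs_le (h1 j dj) _; lia.
by apply: runs_le (h2 j dj) _; lia.
Qed.

Lemma pev_var c i (env : c -> data R) :
  pev (Var i) env (fun j => fst_data (iter i (@snd_data R) (env j))).
Proof.
elim: i env => [|i IH] env /=; first exact: pev_basic.
apply: pev_seq (pev_basic BSnd _) _.
by apply: pev_ext (IH _) _ => j _; rewrite -iterSr.
Qed.

Lemma pev_id c (env : c -> data R) : pev (Basic BId) env env.
Proof. exact: pev_basic. Qed.

Lemma pev_nil c (env : c -> data R) : pev (Basic BNil) env (fun=> Nil).
Proof. exact: pev_basic. Qed.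

Lemma pev_one c (env : c -> data R) : pev (Basic BOne) env (fun=> Num 1).
Proof. exact: pev_basic. Qed.

Lemma pev_fst c e (env u : c -> data R) :
  pev e env u -> pev (Fst e) env (fun j => fst_data (u j)).
Proof. by move/pev_seq; apply; apply: pev_basic. Qed.

Lemma pev_snd c e (env u : c -> data R) :
  pev e env u -> pev (Snd e) env (fun j => snd_data (u j)).
Proof. by move/pev_seq; apply; apply: pev_basic. Qed.

Lemma pev_op c o a b (env u v : c -> data R) :
  pev a env u -> pev b env v ->
  pev (Op o a b) env (fun j => basic_sem (@orc c j) o (Cons (u j) (v j))).
Proof. by move=> ha hb; apply: pev_seq (pev_pair ha hb) (pev_basic _ _). Qed.

Lemma pev_let c a e (env u v : c -> data R) :
  pev a env u -> pev e (fun j => Cons (u j) (env j)) v -> pev (LetIn a e) env v.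
Proof. by move=> ha; apply: pev_seq (pev_pair ha (pev_id _)). Qed.

Lemma pev_and c a b (env : c -> data R) (x y : c -> bool) :
  pev a env (fun j => enc_bool R (x j)) -> pev b env (fun j => enc_bool R (y j)) ->
  pev (And a b) env (fun j => enc_bool R (x j && y j)).
Proof.
move=> ha hb; apply: pev_ext (pev_if ha hb (pev_nil _)) _ => j _.
by case: (x j).
Qed.

(** The time of a call is polynomial in the size of its argument, which must itself be polynomial in
    the size of the outer input. *)
Lemma pev_call c P e (k : nat) (env arg out : c -> data R) :
  pev e env arg ->
  (forall j, dom j -> computes (@no_oracle R) k P (arg j) (out j)) ->
  pbd (fun j => data_size (arg j)) ->
  pev (Seq e (strip_queries P)) env out.
Proof.
move=> he hP hs; apply: pev_seq he _.
exists (fun j => k * data_size (arg j) ^ k)%N.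
  exact: pbd_mul (pbd_const _ _) (pbd_exp _ hs).
move=> j dj; have [t ht lt] := hP j dj.
by exists t => //; apply: run_strip_queries.
Qed.

(** Pairs an input with a loop state but keeps the size of the input alone: a bound over the
    extended family is uniform over all iterations. *)
Definition ext c (X : c -> Type) (D : forall j, X j -> Prop) : ctx :=
  @Ctx {j : c & X j} (fun jx => dom (projT1 jx) /\ D (projT1 jx) (projT2 jx))
    (fun jx => sz (projT1 jx)) (fun jx => @orc c (projT1 jx))
    (fun jx => sz_gt0 (projT1 jx)).

Lemma pbd_ext c X D (g : c -> nat) : pbd g -> pbd (fun jx : @ext c X D => g (projT1 jx)).
Proof. by case=> k hk; exists k => jx [dj _]; apply: hk. Qed.

(** The body may be slow on arbitrary states, so its bound is required only for states satisfying
    [Inv]; this is where bounds on the length of accumulated sequences enter. *)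
Lemma pev_fold c el ei eb (env : c -> data R) (X A : c -> Type)
    (eX : forall j, X j -> data R) (eA : forall j, A j -> data R)
    (s : forall j, seq (X j)) (a0 : forall j, A j)
    (step : forall j, A j -> X j -> A j) (Inv : forall j, A j -> Prop) :
  pev el env (fun j => enc_seq [seq eX j x | x <- s j]) ->
  pev ei env (fun j => eA j (a0 j)) ->
  pbd (fun j => size (s j)) ->
  (forall j, dom j -> Inv j (a0 j)) ->
  (forall j a x, dom j -> Inv j a -> Inv j (step j a x)) ->
  @pev (@ext c (fun j => X j * A j)%type (fun j xa => Inv j xa.2)) eb
    (fun k => Cons (eX (projT1 k) (projT2 k).1)
                (Cons (eA (projT1 k) (projT2 k).2) (env (projT1 k))))
    (fun k => eA (projT1 k) (step (projT1 k) (projT2 k).2 (projT2 k).1)) ->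
  pev (Fold el ei eb) env (fun j => eA j (foldl (step j) (a0 j) (s j))).
Proof.
case=> g1 hg1 h1 [g2 hg2 h2] hs hI hstep [g [k hk] h].
exists (fun j => g1 j + g2 j + size (s j) * (k * sz j ^ k + 20) + 20)%N.
  apply: pbd_add; last exact: pbd_const.
  apply: pbd_add; first exact: pbd_add.
  apply: pbd_mul => //; apply: pbd_add; last exact: pbd_const.
  by apply: pbd_mul; [exact: pbd_const | apply: pbd_exp; exact: pbd_sz].
move=> j dj.
pose a t := eA j (foldl (step j) (a0 j) (take t (s j))).
have Ia : forall t, Inv j (foldl (step j) (a0 j) (take t (s j))).
  move=> t; elim: (take t (s j)) (a0 j) (hI j dj) => //= x s' IH b Ib.
  by apply: IH; apply: hstep.
have := @runs_fold R (@orc c j) el ei eb (env j) [seq eX j x | x <- s j] a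
  (g1 j) (g2 j) (k * sz j ^ k) (h1 j dj).
have -> : a 0%N = eA j (a0 j) by rewrite /a take0.
rewrite size_map; have -> : a (size (s j)) = eA j (foldl (step j) (a0 j) (s j)).
  by rewrite /a take_size.
move=> /(_ (h2 j dj)); apply=> t lt.
have x0 : X j by case: (s j) lt.
have -> : nth Nil [seq eX j x | x <- s j] t = eX j (nth x0 (s j) t).
  exact: (nth_map x0).
have := h (existT _ j (nth x0 (s j) t, foldl (step j) (a0 j) (take t (s j))))
  (conj dj (Ia t)).
rewrite /= -foldl_rcons -take_nth //.
move/runs_le; apply.
exact: (hk (existT _ j (nth x0 (s j) t, foldl (step j) (a0 j) (take t (s j))))
  (conj dj (Ia t))).
Qed.

End Families.

(** * The greedy phases *)

Section CoveringFacts.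
Variables (R : realType) (C : covering R).
Implicit Types (F S A B : {set 'I_(nelt C)}) (X Y : {set 'I_(nreq C)}).

Lemma set_cost0 : set_cost (set0 : {set 'I_(nelt C)}) = 0.
Proof. by rewrite /set_cost big_set0. Qed.

Lemma set_cost_ge0 F : 0 <= set_cost F.
Proof. by apply: sumr_ge0 => e _; apply: cost_ge0. Qed.

Lemma set_costD A B : B \subset A -> set_cost A = set_cost B + set_cost (A :\: B).
Proof. by move=> sBA; rewrite /set_cost (big_setID B) (setIidPr sBA). Qed.

Lemma set_cost_sub A B : A \subset B -> set_cost A <= set_cost B.
Proof. by move/set_costD=> ->; rewrite lerDl set_cost_ge0. Qed.

Lemma set_costU A B : set_cost (A :|: B) <= set_cost A + set_cost B.
Proof.
rewrite (set_costD (subsetUl A B)) lerD2l set_cost_sub //.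
by rewrite setDUl setDv set0U subsetDl.
Qed.

Lemma satisfies_sub A B X : satisfies A X -> A \subset B -> satisfies B X.
Proof.
move=> /forall_inP sA sAB; apply/forall_inP => i Xi.
exact: req_up (sA i Xi) sAB.
Qed.

Lemma satisfiesU A B X Y :
  satisfies A X -> satisfies B Y -> satisfies (A :|: B) (X :|: Y).
Proof.
move=> /(satisfies_sub)/(_ (subsetUl A B))/forall_inP hX.
move=> /(satisfies_sub)/(_ (subsetUr A B))/forall_inP hY.
by apply/forall_inP => i; rewrite inE => /orP[/hX | /hY].
Qed.

Lemma satisfies_subr A X Y : satisfies A X -> Y \subset X -> satisfies A Y.
Proof.
by move=> /forall_inP hX sYX; apply/forall_inP => i /(subsetP sYX)/hX.
Qed.

Lemma satisfies_set0 A : satisfies A (set0 : {set 'I_(nreq C)}).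
Proof. by apply/forall_inP => i; rewrite inE. Qed.

Lemma opt_aug_le X S A : satisfies (S :|: A) X -> opt_aug X S <= set_cost A.
Proof. by move=> h; rewrite /opt_aug; apply: bigmin_le_cond. Qed.

Lemma opt_aug_leT X S : opt_aug X S <= set_cost [set: 'I_(nelt C)].
Proof. exact: bigmin_le_id. Qed.

Lemma opt_aug_attained X S : satisfies setT X ->
  exists2 A, satisfies (S :|: A) X & set_cost A = opt_aug X S.
Proof.
move=> hT; rewrite /opt_aug.
elim/big_ind: _ => [|x y [A hA cA] [B hB cB]|A hA].
- by exists setT => //; rewrite setUT.
- by case: (leP x y) => _; [exists A | exists B].
- by exists A.
Qed.

Lemma opt_aug_ge0 X S : 0 <= opt_aug X S.
Proof.
by rewrite /opt_aug; elim/big_ind: _ => [|x y hx hy|A _];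
  rewrite ?set_cost_ge0 // le_min hx.
Qed.

Lemma opt_aug_sub X S S' : S \subset S' -> satisfies setT X ->
  opt_aug X S' <= opt_aug X S.
Proof.
move=> sSS' /(opt_aug_attained S)[A hA <-]; apply: opt_aug_le.
exact: satisfies_sub hA (setSU _ sSS').
Qed.

(** Buy [S' :\: S], then an optimal augmentation of [S'] for each request separately. *)
Lemma opt_aug_le_sum S S' X : S \subset S' -> satisfies setT X ->
  opt_aug X S <= set_cost S' - set_cost S + \sum_(e in X) opt_aug [set e] S'.
Proof.
move=> sSS' hT.
pose G e := odflt setT [pick A : {set 'I_(nelt C)} | satisfies (S' :|: A) [set e]
                        & set_cost A == opt_aug [set e] S'].
have hG e : e \in X ->
    satisfies (S' :|: G e) [set e] /\ set_cost (G e) = opt_aug [set e] S'.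
  move=> Xe; rewrite /G; case: pickP => [A /andP[hA /eqP cA] //|no].
  have [|A hA cA] := @opt_aug_attained [set e] S'.
    by apply: satisfies_subr hT _; rewrite sub1set.
  by have := no A; rewrite hA cA eqxx.
have -> : \sum_(e in X) opt_aug [set e] S' = \sum_(e in X) set_cost (G e).
  by apply: eq_bigr => e /hG[].
have -> : set_cost S' - set_cost S = set_cost (S' :\: S).
  by rewrite (set_costD sSS') addrAC subrr add0r.
apply: (@le_trans _ _ (set_cost ((S' :\: S) :|: \bigcup_(e in X) G e))).
  have dU : S :|: (S' :\: S) = S' by rewrite -{1}(setIidPr sSS') setID.
  apply: opt_aug_le; rewrite setUA dU.
  apply/forall_inP => e Xe; have [/forall_inP/(_ e (set11 e)) h _] := hG e Xe.
  by apply: req_up h _; rewrite setUS // (bigcup_max e).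
apply: (le_trans (set_costU _ _)); rewrite lerD2l.
elim/big_rec2: _ => [|e A x _ h]; first by rewrite set_cost0.
by apply: le_trans (set_costU _ _) _; rewrite lerD2l.
Qed.

End CoveringFacts.

(** * Greedy phases for a fixed threshold *)

Section Algorithm.
Variables (R : realType) (C : covering R).
Let n := nreq C.
Let m := nelt C.
Variables (M : {set {set 'I_n}}) (q : nat) (w : 'I_q -> 'I_n -> R) (b : 'I_q -> R).
(* Request sequences are kept with the latest request first. *)
Variable g : seq 'I_n -> {set 'I_m}.
Implicit Types (e : 'I_n) (r : seq 'I_n) (S : {set 'I_n}).

(** Merges the knapsacks into one at the loss of a factor [q]: a scenario weighs at most [q]
    ([knapsack_weight]), and a nonempty set of fitting requests that weighs less than 1 meets all
    capacities ([knapsack_sum]). If [b j = 0], the term is 0, and a fitting request has [w j e = 0]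
    anyway. *)
Definition weight e : R := \sum_j w j e / b j.
Definition fits e := [forall j, w j e <= b j].
Definition bought r : R := set_cost (g r).

Record state := State {
  asked : seq 'I_n; added : {set 'I_n}; load : R; paid : R }.
Implicit Types st best : state.

Definition add st e : state :=
  State (e :: asked st) (e |: added st) (load st + weight e) (bought (e :: asked st)).

Variable theta : R.

(** The density test is multiplied by [q], so that for [q = 0], where all weights vanish, it holds
    trivially. *)
Definition admissible st e : bool :=
  [&& e \notin added st, fits e, e |: added st \in M, load st <= q%:R
    & theta * weight e <= q%:R * (bought (e :: asked st) - paid st)].

(** The scan starts with [st] itself as best and replaces it only on strict improvement, so a
    request of zero increment is never made. *)
Definition pick_best st best e : state :=
  if admissible st e && ~~ (bought (e :: asked st) <= paid best) then add st e else best.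

Definition greedy_step st := foldl (pick_best st) st (rev (enum 'I_n)).

Definition start r := State r set0 0 (bought r).

Definition greedy r := iter n greedy_step (start r).

(** Stopping is encoded as leaving [r] unchanged: a failed phase would fail again, and the remaining
    rounds of [phases] are idle. *)
Definition phase r :=
  if paid (greedy r) - bought r <= theta then r else asked (greedy r).

Definition phases := iter m phase [::].

Lemma greedy_stepP st :
  (forall e, admissible st e -> bought (e :: asked st) <= paid (greedy_step st)) /\
  (greedy_step st = st \/
   exists e, [/\ admissible st e, greedy_step st = add st e &
                 paid st < bought (e :: asked st)]).
Proof.
suff h s : let st' := foldl (pick_best st) st s in
    [/\ paid st <= paid st',
      forall e, e \in s -> admissible st e -> bought (e :: asked st) <= paid st' &
     (st' = st \/ exists e, [/\ admissible st e, st' = add st e &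
                               paid st < bought (e :: asked st)])].
  have [_ h1 h2] := h (rev (enum 'I_n)); split=> // e; apply: h1.
  by rewrite mem_rev mem_enum.
elim/last_ind: s => [|s e [lb IH1 IH2]] /=; first by split=> //; left.
rewrite foldl_rcons; set st' := foldl _ _ s in lb IH1 IH2 *.
rewrite {1 2 3 4}/pick_best; case: ifP => [/andP[ae]|nae].
  rewrite -ltNge => lt; split.
  - exact: le_trans (ltW lt).
  - move=> e'; rewrite mem_rcons inE => /predU1P[-> //|se' ae'].
    exact: le_trans (IH1 e' se' ae') (ltW lt).
  - by right; exists e; split=> //; exact: le_lt_trans lt.
split=> // e'; rewrite mem_rcons inE => /predU1P[-> ae|]; last exact: IH1.
by move: nae; rewrite ae /= => /negbT; rewrite negbK.
Qed.

Hypothesis theta_ge0 : 0 <= theta.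
Hypothesis w_ge0 : forall j e, 0 <= w j e.
Hypothesis satT : forall X : {set 'I_n}, satisfies setT X.
Hypothesis g_sat : forall r, satisfies (g r) [set i in r].
Hypothesis g_mono : forall r e, g r \subset g (e :: r).

Lemma fits_div e j : fits e -> 0 <= w j e / b j <= 1.
Proof.
move=> /forallP/(_ j) fe; have := w_ge0 j e; rewrite le_eqVlt => /predU1P[<-|w0].
  by rewrite mul0r lexx ler01.
have b0 := lt_le_trans w0 fe.
apply/andP; split; first by rewrite divr_ge0 // ltW.
by rewrite ler_pdivrMr // mul1r.
Qed.

Lemma weight_ge0 e : fits e -> 0 <= weight e.
Proof. by move=> fe; apply: sumr_ge0 => j _; have /andP[] := fits_div j fe. Qed.

Lemma weight_q0 e : q = 0%N -> weight e = 0.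
Proof.
by move=> q0; apply: big1 => -[j lj]; exfalso; rewrite q0 in lj.
Qed.

Lemma weight_le e : fits e -> weight e <= q%:R.
Proof.
move=> fe; have : weight e <= \sum_(j < q) (1 : R).
  by apply: ler_sum => j _; have /andP[] := fits_div j fe.
by rewrite sumr_const card_ord.
Qed.

(** Invariant of a phase begun at [r]. [reached_dense] sums the density tests; [reached_load_le]
    holds because the load is at most [q] before an addition and a fitting request weighs at most
    [q]; [reached_gt] replaces density when [theta = 0]. *)
Record reached r st : Prop := Reached {
  reached_paid : paid st = bought (asked st);
  reached_sub : g r \subset g (asked st);
  reached_asked : [set i in asked st] = [set i in r] :|: added st;
  reached_added : added st = set0 \/ added st \in M;
  reached_fits : forall e, e \in added st -> fits e;
  reached_load : load st = \sum_(e in added st) weight e;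
  reached_load_le : load st <= 2 * q%:R;
  reached_dense : theta * load st <= q%:R * (paid st - bought r);
  reached_gt : added st != set0 -> bought r < paid st;
  reached_size : (size r <= #|g r| -> size (asked st) <= #|g (asked st)|)%N }.

Lemma reached_start r : reached r (start r).
Proof.
split=> //=; rewrite ?setU0 ?big_set0 ?mulr0 ?subrr ?mulr0 ?eqxx ?mulr_ge0 //.
- by left.
- by move=> e; rewrite inE.
Qed.

Lemma reached_ge r st : reached r st -> bought r <= paid st.
Proof. by move=> h; rewrite (reached_paid h); apply/set_cost_sub/reached_sub. Qed.

Lemma card_bought r e : bought r < bought (e :: r) -> (#|g r| < #|g (e :: r)|)%N.
Proof.
move=> lt; rewrite ltn_neqAle subset_leq_card ?g_mono // andbT.
apply: contraTneq lt => eqc; rewrite -leNgt /bought.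
have /eqP -> // : g r == g (e :: r).
by rewrite eqEcard g_mono -eqc leqnn.
Qed.

Lemma reached_add r st e : reached r st -> admissible st e ->
  paid st < bought (e :: asked st) -> reached r (add st e).
Proof.
move=> h /and5P[ne fe Me lq de] lt; have [h1 h2 h3 h4 h5 h6 h7 h8 h9 h10] := h.
have we := weight_ge0 fe; have we' := weight_le fe.
split=> //=.
- exact: subset_trans (g_mono _ _).
- by rewrite setUCA -h3; apply/setP => i; rewrite !inE.
- by right.
- by move=> e'; rewrite !inE => /predU1P[->|/h5].
- by rewrite big_setU1 //= h6 addrC.
- by rewrite mulr_natl mulr2n lerD.
- rewrite mulrDr; apply: le_trans (lerD h8 de) _.
  by rewrite -mulrDr; have -> : paid st - bought r + (bought (e :: asked st) - paid st) =
    bought (e :: asked st) - bought r by lra.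
- by move=> _; apply: le_lt_trans lt; exact: reached_ge.
- by move/h10/leq_ltn_trans; apply; apply: card_bought; rewrite -h1.
Qed.

Lemma reached_step r st : reached r st -> reached r (greedy_step st).
Proof.
move=> h; have [_ [->//|[e [ae -> lt]]]] := greedy_stepP st.
exact: reached_add.
Qed.

Lemma reached_iter r k : reached r (iter k greedy_step (start r)).
Proof. by elim: k => [|k IH] /=; [exact: reached_start | exact: reached_step]. Qed.

(** An effective step adds a new request to [added], and once all [n] are there none is
    admissible. *)
Lemma greedy_stable r : greedy_step (greedy r) = greedy r.
Proof.
suff [//|full] : greedy_step (greedy r) = greedy r \/ (n <= #|added (greedy r)|)%N.
  have [_ [//|[e [/and5P[ne _ _ _ _] _ _]]]] := greedy_stepP (greedy r).
  have addT : added (greedy r) = setT.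
    by apply/eqP; rewrite eqEcard subsetT cardsT card_ord.
  by rewrite addT inE in ne.
suff H k : let st := iter k greedy_step (start r) in
    greedy_step st = st \/ (k <= #|added st|)%N by exact: H.
elim: k => [|k IH] /=; first by right.
case: IH => [eqk|IH]; first by left; rewrite !eqk.
have [_ [|[e [/and5P[ne _ _ _ _] -> _]]]] := greedy_stepP (iter k greedy_step (start r)).
  by move=> eqk; left; rewrite !eqk.
by right; rewrite /= cardsU1 ne.
Qed.

(** From [q < load st] and density, [theta * q < theta * load st <= q * (paid st - bought r)]. For
    [theta = 0] a single request made suffices. *)
Lemma overload r st : reached r st -> q%:R < load st -> theta < paid st - bought r.
Proof.
case=> h1 h2 h3 h4 h5 h6 h7 h8 h9 h10 lq.
have q0 : 0 < (q%:R : R).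
  rewrite ltr0n lt0n; apply: contraTneq lq => q0; rewrite -leNgt h6.
  by rewrite big1 ?ler0n // => e _; exact: weight_q0.
have [t0|t0] := ltrP 0 theta.
  rewrite -(ltr_pM2l q0); apply: lt_le_trans h8.
  by rewrite mulrC ltr_pM2l.
apply: le_lt_trans t0 _; rewrite subr_gt0; apply: h9.
apply: contraTneq lq => s0; by rewrite -leNgt h6 s0 big_set0 ler0n.
Qed.

(** * Charging a scenario to the greedy requests *)

Section Charging.
Variables (p : R) (omega : {set 'I_n}).
Hypothesis M_sys : p_system p M.
Hypothesis p_ge0 : 0 <= p.
Hypothesis omegaM : omega \in M.
Hypothesis omega_fits : forall e, e \in omega -> fits e.

(** The share [theta * weight e / q] is deducted from the cost of augmenting for [e]; over a
    scenario these shares add up to at most [theta]. *)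
Let unpaid st e : R := opt_aug [set e] (g (asked st)) - theta * weight e / q%:R.
Let blocked st := [set e in omega | e |: added st \notin M].

(** Inside [added st :|: blocked st] the set [added st] is maximal, while [blocked st], a part of
    [omega] and hence in [M], extends to another maximal member. *)
Lemma card_blocked r st : reached r st -> #|blocked st|%:R <= p * #|added st|%:R.
Proof.
move=> h; have [Mdown Mmax] := M_sys.
have aM : added st \in M.
  by case: (reached_added h) => // ->; apply: Mdown omegaM (sub0set _).
pose A := added st :|: blocked st.
have [B mB sB] : {B | maxset (fun B => (B \in M) && (B \subset A)) B & blocked st \subset B}.
  apply: maxset_exists; rewrite subsetUr andbT; apply: Mdown omegaM _.
  by apply/subsetP => e; rewrite inE => /andP[].
apply: le_trans (Mmax A B (added st) mB _); first by rewrite ler_nat subset_leq_card.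
apply/maxsetP; split; first by rewrite aM subsetUl.
move=> B' /andP[B'M sB'A] sB'; apply/eqP; rewrite eqEsubset sB' andbT.
apply/subsetP => e B'e; move: (subsetP sB'A e B'e); rewrite inE => /orP[//|].
rewrite inE => /andP[_ /negP[]]; apply: Mdown B'M _.
by rewrite subUset sub1set B'e.
Qed.

(** What the online algorithm would buy on request [e] is a feasible augmentation for [e]. *)
Lemma unpaid_le_step st e : paid st = bought (asked st) ->
  unpaid st e <= bought (e :: asked st) - paid st - theta * weight e / q%:R.
Proof.
move=> ->; rewrite lerD2r /bought (set_costD (g_mono _ e)) addrAC subrr add0r.
apply: opt_aug_le.
have dU : g (asked st) :|: (g (e :: asked st) :\: g (asked st)) = g (e :: asked st).
  by rewrite -{1}(setIidPr (g_mono _ e)) setID.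
rewrite dU; apply: satisfies_subr (g_sat (e :: asked st)) _.
by rewrite sub1set !inE eqxx.
Qed.

(* An element rejected for its low density is paid for by its weight. *)
Lemma unpaid_free st e : paid st = bought (asked st) -> load st <= q%:R ->
  e \in omega -> e \notin added st -> e |: added st \in M ->
  ~~ admissible st e -> unpaid st e <= 0.
Proof.
move=> h1 lq oe ne Me; rewrite /admissible ne Me lq omega_fits //= -ltNge => lt.
apply: le_trans (unpaid_le_step e h1) _; rewrite subr_le0.
have q0 : 0 < (q%:R : R).
  rewrite ltr0n lt0n; apply: contraTneq lt => q0; rewrite -leNgt.
  by rewrite (weight_q0 _ q0) q0 mul0r mulr0.
by rewrite ler_pdivlMr // mulrC ltW.
Qed.

(* [mu], the smallest increment so far, bounds the unpaid cost of each request
   that is still allowed; [p * #|added st| - #|blocked st|] is the number of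
   blocked requests that the increments made so far can still pay for. *)
Let charged r st := exists mu : R, [/\ 0 <= mu,
  \sum_(e in blocked st) unpaid st e + mu * (p * #|added st|%:R - #|blocked st|%:R)
     <= p * (paid st - bought r) &
  forall e, e \in omega -> e \notin added st -> e |: added st \in M -> unpaid st e <= mu].

(** Adding [e0] with increment [delta] raises the right side by [p * delta], which pays for [p]
    further units of [mu' = min mu delta]. A newly blocked request was still allowed before the
    step, so its unpaid cost is at most [mu'] and it uses up one unit. Lowering [mu] to [mu'] is
    harmless since the number of free units is nonnegative ([card_blocked]). *)
Lemma charged_step r st : reached r st -> charged r st -> charged r (greedy_step st).
Proof.
move=> h [mu [mu0 hsum hmu]].
have [best [->|[e0 [ae0 st' lt]]]] := greedy_stepP st; first by exists mu.
rewrite st' /= in best; rewrite st'.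
have {st'} h' := reached_add h ae0 lt.
have [Mdown _] := M_sys.
pose delta := bought (e0 :: asked st) - paid st.
have delta0 : 0 < delta by rewrite subr_gt0.
have lq : load st <= q%:R by case/and5P: ae0.
have ne0 : e0 \notin added st by case/and5P: ae0.
pose mu' := Num.min mu delta.
have mu'0 : 0 <= mu' by rewrite le_min mu0 ltW.
(* Greedy choice: an admissible request has increment at most [delta], and one that is allowed by
   [M] but inadmissible is covered by its weight share. *)
have low e : e \in omega -> e \notin added st -> e |: added st \in M -> unpaid st e <= mu'.
  move=> oe ne Me; rewrite le_min hmu //=; case: (boolP (admissible st e)) => ae.
    apply: le_trans (unpaid_le_step e (reached_paid h)) _.
    have := best e ae; rewrite /delta.
    have : 0 <= theta * weight e / q%:R.
      by rewrite divr_ge0 ?ler0n // mulr_ge0 // weight_ge0 // omega_fits.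
    lra.
  by apply: le_trans (unpaid_free (reached_paid h) lq oe ne Me ae) (ltW delta0).
have dec e : unpaid (add st e0) e <= unpaid st e.
  by rewrite lerD2r; apply: opt_aug_sub; [exact: g_mono | exact: satT].
have sb : blocked st \subset blocked (add st e0).
  apply/subsetP => e; rewrite !inE => /andP[-> /=]; apply: contra => Me.
  by apply: Mdown Me _; rewrite setUS // subsetUr.
exists mu'; split=> //=; last first.
  move=> e oe; rewrite inE negb_or => /andP[_ ne] Me.
  apply: le_trans (dec e) (low e oe ne _).
  by apply: Mdown Me _; rewrite setUS // subsetUr.
have new : \sum_(e in blocked (add st e0) :\: blocked st) unpaid (add st e0) e
    <= mu' * (#|blocked (add st e0)|%:R - #|blocked st|%:R).
  rewrite -natrB ?subset_leq_card //.
  have -> : (#|blocked (add st e0)| - #|blocked st| = #|blocked (add st e0) :\: blocked st|)%N.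
    by rewrite cardsD (setIidPr sb).
  rewrite mulr_natr -sumr_const; apply: ler_sum => e.
  rewrite !inE => /andP[nb /andP[oe Me]].
  have {}nb : e |: added st \in M by move: nb; rewrite oe negbK.
  apply: le_trans (dec e) (low e oe _ nb).
  apply: contra Me => ae; rewrite (setUidPr _) ?sub1set ?inE ?ae ?orbT //.
  by case/and5P: ae0.
have old : \sum_(e in blocked st) unpaid (add st e0) e <= \sum_(e in blocked st) unpaid st e.
  by apply: ler_sum => e _.
have slack : mu' * (p * #|added st|%:R - #|blocked st|%:R) <=
             mu * (p * #|added st|%:R - #|blocked st|%:R).
  by apply: ler_wpM2r; [rewrite subr_ge0 (card_blocked h) | rewrite ge_min lexx].
have pd : mu' * p <= delta * p by apply: ler_wpM2r => //; rewrite ge_min lexx orbT.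
rewrite (big_setID (blocked st)) /= (setIidPr sb) cardsU1 ne0 natrD.
move: new old slack pd hsum; rewrite /delta /=.
set s1 := \sum_(_ in _) _; set s2 := \sum_(_ in _) _; set s3 := \sum_(_ in _) _.
set x := #|_|%:R; set y := #|_|%:R; set z := #|_|%:R; set v := bought (_ :: _).
nra.
Qed.

Lemma charged_greedy r : charged r (greedy r).
Proof.
suff H k : charged r (iter k greedy_step (start r)) by exact: H.
elim: k => [|k IH].
  (* Before the first increment any upper bound on the unpaid costs serves as [mu]: nothing is added
     or blocked, so it is multiplied by 0. *)
  exists (set_cost [set: 'I_m]); split=> /=; first exact: set_cost_ge0.
    have -> : blocked (start r) = set0.
      apply/setP => e; rewrite !inE /= setU0.
      case oe: (e \in omega) => //=; apply/negbTE; rewrite negbK.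
      by apply: M_sys.1 omegaM _; rewrite sub1set.
    by rewrite big_set0 cards0 subrr !mulr0 subrr mulr0 addr0.
  move=> e oe _ _; rewrite lerBlDr; apply: le_trans (opt_aug_leT _ _) _.
  by rewrite lerDl divr_ge0 ?ler0n // mulr_ge0 // weight_ge0 // omega_fits.
rewrite iterS; apply: charged_step => //; exact: reached_iter.
Qed.

Hypothesis omega_weight : \sum_(e in omega) weight e <= q%:R.

(** The purchases of the discarded last phase serve as an intermediate set and cost at most [theta];
    blocked requests cost [p * theta] beyond their weight shares, and the shares another [theta].
    All other requests of [omega] have no unpaid cost. *)
Lemma greedy_augment r : paid (greedy r) - bought r <= theta ->
  opt_aug omega (g r) <= (p + 2) * theta.
Proof.
move=> small.
have h : reached r (greedy r) by exact: reached_iter.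
have lq : load (greedy r) <= q%:R.
  by rewrite leNgt; apply/negP => /(overload h); rewrite ltNge small.
have [mu [mu0 hsum _]] := charged_greedy r.
(* At the fixed point an admissible request has no positive increment. *)
have stay : forall e, e \in omega -> e \notin added (greedy r) ->
    e |: added (greedy r) \in M -> unpaid (greedy r) e <= 0.
  move=> e oe ne Me; case: (boolP (admissible (greedy r) e)) => ae; last first.
    exact: unpaid_free (reached_paid h) lq oe ne Me ae.
  have [best _] := greedy_stepP (greedy r).
  have := best e ae; rewrite greedy_stable => be.
  apply: le_trans (unpaid_le_step e (reached_paid h)) _.
  have : 0 <= theta * weight e / q%:R.
    by rewrite divr_ge0 ?ler0n // mulr_ge0 // weight_ge0 // omega_fits.
  lra.
have bound : \sum_(e in omega) unpaid (greedy r) e <= p * theta.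
  rewrite (big_setID (blocked (greedy r))) /= (setIidPr _); last first.
    by apply/subsetP => e; rewrite inE => /andP[].
  have -> : p * theta = p * theta + 0 by rewrite addr0.
  apply: lerD.
    apply: le_trans (_ : p * (paid (greedy r) - bought r) <= _); last exact: ler_wpM2l.
    apply: le_trans hsum; rewrite lerDl mulr_ge0 // subr_ge0; exact: card_blocked h.
  apply: sumr_le0 => e; rewrite !inE => /andP[nb oe]; rewrite oe negbK /= in nb.
  case: (boolP (e \in added (greedy r))) => [ae|ne]; last exact: stay.
  apply: (@le_trans _ _ (set_cost (set0 : {set 'I_m}) - theta * weight e / q%:R)).
    rewrite lerD2r; apply: opt_aug_le; rewrite setU0.
    apply: satisfies_subr (g_sat _) _; rewrite sub1set (reached_asked h) inE ae orbT //.
  rewrite set_cost0 sub0r oppr_le0 divr_ge0 ?ler0n // mulr_ge0 // weight_ge0 //.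
  exact: omega_fits.
have dens : \sum_(e in omega) theta * weight e / q%:R <= theta.
  rewrite -mulr_suml -mulr_sumr.
  have [q0|] := posnP q; first by rewrite q0 invr0 mulr0.
  by rewrite -(ltr0n R) => q0; rewrite ler_pdivrMr // ler_wpM2l.
apply: le_trans (opt_aug_le_sum (reached_sub h) (satT omega)) _.
have := reached_paid h; rewrite /bought => <-.
rewrite big_split /= sumrN in bound; move: small bound dens; rewrite /bought; lra.
Qed.

End Charging.

(** The violated capacity alone contributes at least 1. It is not negative, as some request fits,
    and not 0, as fitting requests would then have weight 0 there and violate nothing. *)
Lemma knapsack_sum S : (forall e, e \in S -> fits e) -> S \notin knapsacks w b ->
  S != set0 -> 1 <= \sum_(e in S) weight e.
Proof.
move=> Sf; rewrite inE => /forallPn[j]; rewrite -ltNge => lt /set0Pn[e0 Se0].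
have b0 : 0 <= b j by apply: le_trans (w_ge0 j e0) _; exact: (forallP (Sf e0 Se0)).
have {}b0 : 0 < b j.
  move: b0; rewrite le_eqVlt => /predU1P[b0|//].
  move: lt; rewrite big1 -?b0 ?ltxx // => e Se; apply/eqP; rewrite eq_le w_ge0 andbT.
  by rewrite b0; exact: (forallP (Sf e Se)).
have : 1 <= \sum_(e in S) w j e / b j by rewrite -mulr_suml ler_pdivlMr // mul1r ltW.
move/le_trans; apply; apply: ler_sum => e Se; rewrite /weight (bigD1 j) //= lerDl.
by apply: sumr_ge0 => k _; have /andP[] := fits_div k (Sf e Se).
Qed.

Lemma knapsack_weight S : S \in knapsacks w b -> \sum_(e in S) weight e <= q%:R.
Proof.
rewrite inE => /forallP SK; rewrite /weight exchange_big /=.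
have -> : q%:R = \sum_(j < q) (1 : R) by rewrite sumr_const card_ord.
apply: ler_sum => j _; rewrite -mulr_suml.
have S0 : 0 <= \sum_(e in S) w j e by apply: sumr_ge0.
have := le_trans S0 (SK j); rewrite le_eqVlt => /predU1P[<-|bj].
  by rewrite invr0 mulr0 ler01.
by rewrite ler_pdivrMr // mul1r.
Qed.

Lemma knapsack_fits S e : S \in knapsacks w b -> e \in S -> fits e.
Proof.
rewrite inE => /forallP SK Se; apply/forallP => j; apply: le_trans (SK j).
by rewrite (bigD1 e) //= lerDl sumr_ge0.
Qed.

(** * Covering kept phases by few scenarios, and the number of phases *)

Section Packing.
Variables (E0 : {set 'I_m}) (Es : {set 'I_n} -> {set 'I_m}) (T : R).
Hypothesis M_down : forall A B : {set 'I_n}, A \in M -> B \subset A -> B \in M.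
Hypothesis T_ge0 : 0 <= T.
Hypothesis Es_sat : forall om, om \in M :&: knapsacks w b -> satisfies (E0 :|: Es om) om.
Hypothesis Es_cost : forall om, om \in M :&: knapsacks w b -> set_cost (Es om) <= T.

(* [B] is the bin being filled, and [A] covers the closed bins.  A bin is closed
   when it overflows together with the next element, so that closing it and
   opening the next one costs [T] but involves a weight of at least 1. *)
Lemma packing S : S \in M -> (forall e, e \in S -> fits e) ->
  exists (A : {set 'I_m}) (B : {set 'I_n}), [/\ B \subset S, B = set0 \/ B \in M :&: knapsacks w b,
    satisfies (E0 :|: A) (S :\: B) &
    set_cost A <= (2 * (\sum_(e in S :\: B) weight e) + \sum_(e in B) weight e) * T].
Proof.
have [k] := ubnP #|S|; elim: k S => // k IH S; rewrite ltnS => Sk SM Sf.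
have [->|[e Se]] := set_0Vmem S.
  exists set0, set0; rewrite setD0 !big_set0 set_cost0 mulr0 addr0 mul0r; split=> //.
    by left.
  exact: satisfies_set0.
have sS : S :\ e \subset S by exact: subD1set.
have [|||A [B [sB hB satA cA]]] := IH (S :\ e).
- by move: Sk; rewrite (cardsD1 e) Se add1n.
- exact: M_down SM sS.
- by move=> e' /(subsetP sS)/Sf.
have neB : e \notin B.
  by apply/negP => /(subsetP sB); rewrite !inE eqxx.
have eBS : e |: B \subset S by rewrite subUset sub1set Se (subset_trans sB).
have BS0 e' : e' \in B -> 0 <= weight e'.
  by move=> Be'; apply/weight_ge0/Sf/(subsetP sS)/(subsetP sB).
case: (boolP (e |: B \in knapsacks w b)) => [eBK|neBK].
  exists A, (e |: B); split=> //.
  - by right; rewrite inE eBK (M_down SM eBS).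
  - by rewrite -setDDl.
  - rewrite -setDDl; apply: le_trans cA _; apply: ler_wpM2r => //.
    by rewrite lerD2l big_setU1 //= lerDr weight_ge0 // Sf.
have eK : [set e] \in M :&: knapsacks w b.
  rewrite inE (M_down SM) ?sub1set //= inE; apply/forallP => j.
  by rewrite big_set1; exact: (forallP (Sf e Se)).
have {hB}BO : B \in M :&: knapsacks w b.
  case: hB => // B0; move: neBK; rewrite B0 setU0.
  by move: eK; rewrite inE => /andP[_ ->].
have one : 1 <= weight e + \sum_(e in B) weight e.
  rewrite -big_setU1 //=; apply: knapsack_sum neBK _.
    by move=> e' /(subsetP eBS)/Sf.
  by apply/set0Pn; exists e; rewrite setU11.
exists (A :|: Es B), [set e]; split.
- by rewrite sub1set.
- by right.
- have := satisfiesU satA (Es_sat BO); rewrite setUACA setUid.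
  move/satisfies_subr; apply; apply/subsetP => e' Se'.
  by move: Se'; rewrite !inE => /andP[-> ->]; case: (e' \in B).
- apply: le_trans (set_costU _ _) _; apply: le_trans (lerD cA (Es_cost BO)) _.
  (* The bracket grows by the weights of [e] and [B] together, at least 1 by [one], which pays the
     cost [T] of [Es B]. *)
  rewrite -{2}(mul1r T) -mulrDl; apply: ler_wpM2r => //.
  rewrite big_set1 [in leRHS](big_setID B) /= (setIidPr sB) mulrDr.
  by move: one; lra.
Qed.

(** Weight at most [2 * q] gives closed bins of total cost at most [4 * q * T]; the last, open bin
    adds one more [T]. *)
Lemma cover_packing S : S = set0 \/ S \in M -> (forall e, e \in S -> fits e) ->
  \sum_(e in S) weight e <= 2 * q%:R ->
  exists A : {set 'I_m}, satisfies (E0 :|: A) S /\ set_cost A <= (4 * q%:R + 1) * T.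
Proof.
case=> [-> _ _|SM Sf Sw].
  exists set0; rewrite set_cost0 mulr_ge0 ?addr_ge0 ?mulr_ge0 ?ler0n ?ler01 //.
  by split=> //; exact: satisfies_set0.
have [A [B [sB hB satA cA]]] := packing SM Sf.
have B0 : 0 <= \sum_(e in B) weight e.
  by apply: sumr_ge0 => e /(subsetP sB)/Sf; exact: weight_ge0.
have Sw' : 2 * (\sum_(e in S :\: B) weight e) + \sum_(e in B) weight e <= 4 * q%:R.
  move: Sw; rewrite (big_setID B) /= (setIidPr sB); lra.
have {}cA := le_trans cA (ler_wpM2r T_ge0 Sw').
case: hB => [B_0|BO].
  exists A; split; first by move: satA; rewrite B_0 setD0.
  by apply: le_trans cA _; rewrite [leRHS]mulrDl mul1r lerDl.
exists (A :|: Es B); split.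
  have := satisfiesU satA (Es_sat BO); rewrite setUACA setUid.
  move/satisfies_subr; apply; apply/subsetP => e Se.
  by rewrite !inE Se; case: (e \in B).
by apply: le_trans (set_costU _ _) _; rewrite [leRHS]mulrDl mul1r; exact: lerD cA (Es_cost BO).
Qed.

(** [target] may exceed [theta]: the increment of a kept phase is the cost of a set, and when no
    such cost lies between the two, passing [theta] means reaching [target]. *)
Variable target : R.
Hypothesis target_le : forall D : {set 'I_m}, theta < set_cost D -> target <= set_cost D.

(** [N] counts the kept phases. The optimal first stage [E0] is shared by all of them, and only the
    covers by scenarios add up. *)
Lemma phases_lower : exists N : nat,
  opt [set i in phases] <= set_cost E0 + N%:R * ((4 * q%:R + 1) * T) /\
  N%:R * target <= bought phases.
Proof.
suff H k : exists (N : nat) (A : {set 'I_m}), let r := iter k phase [::] in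
    [/\ satisfies (E0 :|: A) [set i in r], set_cost A <= N%:R * ((4 * q%:R + 1) * T) &
        N%:R * target <= bought r].
  have [N [A [satA cA h]]] := H m.
  exists N; split=> //; apply: le_trans (opt_aug_le _ : _ <= set_cost (E0 :|: A)) _.
    by rewrite set0U.
  by apply: le_trans (set_costU _ _) _; rewrite lerD2l.
elim: k => [|k [N [A [satA cA h]]]].
  exists 0%N, set0; rewrite !mul0r set_cost0; split=> //; last exact: set_cost_ge0.
  by apply/forall_inP => i; rewrite inE in_nil.
rewrite /=; set r := iter k phase [::] in satA h *.
rewrite /phase; case: ifP => [_|/negbT]; first by exists N, A.
rewrite -ltNge => big.
have st : reached r (greedy r) by exact: reached_iter.
have [|A' [satA' cA']] := cover_packing (reached_added st) (reached_fits st).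
  by rewrite -(reached_load st); exact: reached_load_le st.
exists N.+1, (A :|: A'); split.
- by rewrite (reached_asked st) -[E0]setUid setUACA; exact: satisfiesU.
- by rewrite -natr1 mulrDl mul1r; apply: le_trans (set_costU _ _) (lerD cA cA').
- rewrite -natr1 mulrDl mul1r -(reached_paid st).
  have dif : paid (greedy r) - bought r = set_cost (g (asked (greedy r)) :\: g r).
    rewrite (reached_paid st) /bought (set_costD (reached_sub st)).
    by rewrite addrAC subrr add0r.
  by have := target_le (D := g (asked (greedy r)) :\: g r); rewrite -dif => /(_ big); lra.
Qed.

End Packing.

(** A kept phase strictly enlarges the online solution, so after [m] of them it is the whole ground
    set and nothing is left to buy. *)
Lemma phases_small : paid (greedy phases) - bought phases <= theta.
Proof.
suff H k : let r := iter k phase [::] in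
    paid (greedy r) - bought r <= theta \/ (k <= #|g r|)%N.
  have [//|full] := H m; rewrite -/phases in full.
  have st : reached phases (greedy phases) by exact: reached_iter.
  have gT : g phases = setT by apply/eqP; rewrite eqEcard subsetT cardsT card_ord.
  suff -> : paid (greedy phases) - bought phases = 0 by [].
  rewrite (reached_paid st) /bought gT; have := reached_sub st.
  by rewrite gT subTset => /eqP ->; rewrite subrr.
elim: k => [|k IH] /=; first by right.
set r := iter k phase [::] in IH *; rewrite {1 2 3}/phase.
case: ifP => [small|]; first by left; rewrite small.
case: IH => [-> //|IH /negbT]; rewrite -ltNge => big; right.
have st : reached r (greedy r) by exact: reached_iter.
apply: leq_ltn_trans IH _; rewrite ltn_neqAle subset_leq_card ?(reached_sub st) // andbT.
apply: contraTneq big => eqc; rewrite -leNgt (reached_paid st) /bought.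
suff /eqP <- : g r == g (asked (greedy r)) by rewrite subrr.
by rewrite eqEcard (reached_sub st) -eqc leqnn.
Qed.

End Algorithm.

(** * Choice of the threshold and approximation ratio *)

Section Thresholds.
Variable R : realType.
Implicit Types (x t : R) (s l : seq R).

(** The list [s] only counts: [i * x] is pushed onto [l] for [i] from 1 to [size s]. The accumulator
    form is the one that the program [Thresholds] follows. *)
Definition multiples x s l : seq R * R :=
  foldl (fun a _ => (a.2 + x :: a.1, a.2 + x)) (l, 0) s.

Definition thresholds s : seq R := foldl (fun l x => (multiples x s l).1) [:: 0] s.

Lemma multiplesP x s l : (multiples x s l).2 = (size s)%:R * x /\
  forall z, z \in (multiples x s l).1 <->
    z \in l \/ exists2 i, (0 < i <= size s)%N & z = i%:R * x.
Proof.
rewrite /multiples; elim/last_ind: s => [|s y [IH1 IH2]] /=.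
  split; first by rewrite mul0r.
  by move=> z; split=> [->|[//|[[|i]]]] //; left.
rewrite foldl_rcons /= IH1 size_rcons -natr1 mulrDl mul1r; split=> // z.
rewrite inE; split=> [/predU1P[->|/IH2[|[i /andP[i0 iz] zi]]]|].
- by right; exists (size s).+1; rewrite ?ltnSn // -natr1 mulrDl mul1r.
- by left.
- by right; exists i => //; rewrite i0 leqW.
- case=> [zl|[i /andP[i0]]]; first by apply/orP; right; apply/IH2; left.
  rewrite leq_eqVlt => /predU1P[-> ->|iz zi].
    by rewrite -natr1 mulrDl mul1r eqxx.
  by apply/orP; right; apply/IH2; right; exists i => //; rewrite i0.
Qed.

Lemma thresholdsP s z : z \in thresholds s <->
  z = 0 \/ exists i x, [/\ x \in s, (0 < i <= size s)%N & z = i%:R * x].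
Proof.
suff H s1 : z \in foldl (fun l x => (multiples x s l).1) [:: 0] s1 <->
    z = 0 \/ exists i x, [/\ x \in s1, (0 < i <= size s)%N & z = i%:R * x].
  exact: H.
elim/last_ind: s1 => [|s1 y IH] /=.
  rewrite inE; split=> [/eqP ->|[->|[i [x []]]]] //; by left.
rewrite foldl_rcons.
have [_ ->] := multiplesP y s (foldl (fun l x => (multiples x s l).1) [:: 0] s1).
rewrite IH; split=> [[[->|[i [x [xs si ->]]]]|[i si ->]]|[->|[i [x []]]]].
- by left.
- by right; exists i, x; rewrite mem_rcons inE xs orbT.
- by right; exists i, y; rewrite mem_rcons inE eqxx.
- by left; left.
- rewrite mem_rcons inE => /predU1P[->|xs] si ->; first by right; exists i.
  by left; right; exists i, x.
Qed.

End Thresholds.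

(** * The choice of the threshold and the ratio it gives *)

Section Selection.
Variables (R : realType) (C : covering R).
Let costs := [seq @cost R C e | e <- enum 'I_(nelt C)].

Lemma thresholds_ge0 z : z \in thresholds costs -> 0 <= z.
Proof.
case/thresholdsP => [->//|[i [x [/mapP[e _ ->] _ ->]]]].
by rewrite mulr_ge0 ?ler0n // cost_ge0.
Qed.

Lemma cost_le_set_cost e (D : {set 'I_(nelt C)}) : e \in D -> cost e <= set_cost D.
Proof.
by move=> De; rewrite /set_cost (bigD1 e) //= lerDl sumr_ge0 // => *; exact: cost_ge0.
Qed.

(* With [e] the most expensive element of cost at most [t], the costs of sets
   that lie between [nelt C * cost e] and [t] do not occur, so a multiple of
   [cost e] can replace [t]. *)
Lemma threshold_near t : 0 <= t -> exists z, [/\ z \in thresholds costs, z <= 2 * t &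
  forall D : {set 'I_(nelt C)}, z < set_cost D -> t <= set_cost D].
Proof.
move=> t0.
have big_elt (D : {set 'I_(nelt C)}) e : e \in D -> ~~ (cost e <= t) -> t <= set_cost D.
  by move=> De; rewrite -ltNge => /ltW/le_trans; apply; apply: cost_le_set_cost.
(* If no element costs at most [t], every nonempty set costs at least [t], and the threshold 0 will
   do. *)
case: (pickP (fun e : 'I_(nelt C) => cost e <= t)) => [e0 e0t|none]; last first.
  exists 0; split; [by apply/thresholdsP; left | by rewrite mulr_ge0 |].
  move=> D; have [->|[e De] _] := set_0Vmem D; first by rewrite set_cost0 ltxx.
  by apply: big_elt De _; rewrite none.
have [e et emax] := @arg_maxP _ _ _ e0 (fun e => cost e <= t) (@cost R C) e0t.
have e_mem : cost e \in costs by rewrite map_f // mem_enum.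
have size_costs : size costs = nelt C by rewrite size_map size_enum_ord.
have m0 : (0 < nelt C)%N by exact: leq_ltn_trans (leq0n e) (ltn_ord e).
case: (lerP t ((nelt C)%:R * cost e)) => tm.
  have ex : exists i, t <= i%:R * cost e by exists (nelt C).
  case: (ex_minnP ex) => -[|i] ti imin.
    have {}t0 : t = 0 by apply/eqP; rewrite eq_le t0 andbT; rewrite mul0r in ti.
    exists 0; rewrite t0 mulr0; split=> //; first by apply/thresholdsP; left.
    by move=> D _; exact: set_cost_ge0.
  (* By minimality [i * cost e < t], and [cost e <= t] yields the factor 2. *)
  exists (i.+1%:R * cost e); split.
  - by apply/thresholdsP; right; exists i.+1, (cost e); rewrite size_costs imin.
  - have : ~~ (t <= i%:R * cost e) by apply/negP => /imin; rewrite ltnn.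
    rewrite -ltNge -natr1 mulrDl mul1r => lt; move: (et : is_true (cost e <= t)); lra.
  - by move=> D /ltW; exact: le_trans.
exists ((nelt C)%:R * cost e); split.
- by apply/thresholdsP; right; exists (nelt C), (cost e); rewrite size_costs m0 leqnn.
- lra.
(* A set of elements of cost at most [t] costs at most [nelt C * cost e], so [D] has an element
   costing more than [t]. *)
move=> D lt; case: (boolP [forall e' in D, cost e' <= t]) => [/forall_inP small|].
  suff : set_cost D <= (nelt C)%:R * cost e by rewrite leNgt lt.
  apply: (@le_trans _ _ (\sum_(e' in D) cost e)).
    by apply: ler_sum => e' De'; apply: emax; exact: small.
  rewrite sumr_const -[leLHS]mulr_natl; apply: ler_wpM2r; first exact: cost_ge0.
  rewrite ler_nat; by rewrite -[leqRHS]card_ord max_card.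
by case/forall_inPn => e' De'; exact: big_elt.
Qed.

Let n := nreq C.
Let m := nelt C.
Variables (M : {set {set 'I_n}}) (q : nat) (w : 'I_q -> 'I_n -> R) (b : 'I_q -> R).
Variables (g : seq 'I_n -> {set 'I_m}) (lam : R).

Let sol theta := phases M w b g theta.

Definition score theta : R := bought g (sol theta) + lam * theta.

Definition keep_best (acc : option R) theta : option R :=
  if acc is Some theta' then
    if score theta' <= score theta then Some theta' else Some theta
  else Some theta.

Definition best_threshold : option R := foldl keep_best None (thresholds costs).

Lemma best_thresholdP : exists theta, [/\ best_threshold = Some theta,
  theta \in thresholds costs &
  forall z, z \in thresholds costs -> score theta <= score z].
Proof.
suff H s : s != [::] -> exists theta, [/\ foldl keep_best None s = Some theta,
    theta \in s & forall z, z \in s -> score theta <= score z].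
  apply: H; apply/eqP => t0.
  by have := (thresholdsP costs 0).2 (or_introl erefl); rewrite t0.
elim/last_ind: s => // s x IH _; rewrite foldl_rcons.
have [->|/IH[theta [-> ths hth]]] := eqVneq s [::].
  by exists x; split; rewrite ?inE // => z; rewrite inE => /eqP ->.
rewrite /=; case: (lerP (score theta) (score x)) => h.
  exists theta; split=> //; first by rewrite mem_rcons inE ths orbT.
  by move=> z; rewrite mem_rcons inE => /predU1P[->|/hth].
exists x; split=> //; first by rewrite mem_rcons mem_head.
move=> z; rewrite mem_rcons inE => /predU1P[-> //|/hth]; exact: le_trans (ltW h).
Qed.

Variables (p alpha_off alpha_on : R).
Hypothesis M_sys : p_system p M.
Hypothesis w_ge0 : forall j e, 0 <= w j e.
Hypothesis lam_ge1 : 1 <= lam.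
Hypothesis off : forall (S : {set 'I_m}) (X : {set 'I_n}),
  exists2 A, satisfies (S :|: A) X & set_cost A <= alpha_off * opt_aug X S.
Hypothesis g_sat : forall r, satisfies (g r) [set i in r].
Hypothesis g_mono : forall r e, g r \subset g (e :: r).
Hypothesis g_comp : forall r, bought g r <= alpha_on * opt [set i in r].

Let Omega := M :&: knapsacks w b.

Lemma offline_satT (X : {set 'I_n}) : satisfies [set: 'I_m] X.
Proof. by have [A h _] := off set0 X; apply: satisfies_sub h (subsetT _). Qed.

Lemma le_max_cost (Ew : {ffun {set 'I_n} -> {set 'I_m}}) om : om \in Omega ->
  set_cost (Ew om) <= \big[Order.max/0]_(om in Omega) set_cost (Ew om).
Proof. by move=> Oom; rewrite (bigD1 om) //= le_max lexx. Qed.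

Lemma max_cost_le (Ew : {ffun {set 'I_n} -> {set 'I_m}}) (x : R) : 0 <= x ->
  (forall om, om \in Omega -> set_cost (Ew om) <= x) ->
  \big[Order.max/0]_(om in Omega) set_cost (Ew om) <= x.
Proof.
move=> x0 h; elim/big_ind: _ => // y z hy hz; by rewrite ge_max hy.
Qed.

Lemma max_cost_ge0 (Ew : {ffun {set 'I_n} -> {set 'I_m}}) :
  0 <= \big[Order.max/0]_(om in Omega) set_cost (Ew om).
Proof.
elim/big_ind: _ => // [y z hy hz|om _]; by [rewrite le_max hy | exact: set_cost_ge0].
Qed.

Lemma robust_opt_attained : exists E0 Ew,
  robust_feasible Omega E0 Ew /\ robust_value Omega lam E0 Ew = robust_opt Omega lam.
Proof.
rewrite /robust_opt; elim/big_ind: _ => [|x y hx hy|[E0 Ew] /= h].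
- exists setT, [ffun=> set0]; split.
    by apply/forall_inP => om _; rewrite setTU; exact: offline_satT.
  rewrite /robust_value (_ : \big[Order.max/0]_(om in Omega) _ = 0) ?mulr0 ?addr0 //.
  apply/eqP; rewrite eq_le max_cost_ge0 andbT max_cost_le // => om _.
  by rewrite ffunE set_cost0.
- by case: (leP x y).
- by exists E0, Ew.
Qed.

(** If every scenario had optimum 0, an empty first stage with optimal second stages would cost
    0. *)
Lemma robust_opt_gt0 : 0 < robust_opt Omega lam ->
  exists2 om, om \in Omega & 0 < opt om.
Proof.
move=> pos; case: (pickP (fun om => (om \in Omega) && (0 < opt om))) => [om /andP[]|none].
  by exists om.
have att (om : {set 'I_n}) : exists A : {set 'I_m}, satisfies A om /\ set_cost A = opt om.
  have [A h cA] := opt_aug_attained set0 (offline_satT om).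
  by exists A; split=> //; move: h; rewrite set0U.
have [A hA] := choice att.
pose Ew := [ffun om => A om].
have : robust_opt Omega lam <= robust_value Omega lam set0 Ew.
  rewrite /robust_opt; apply: (@bigmin_le_cond _ _ _ _ (set0, Ew)).
  by apply/forall_inP => om _; rewrite set0U ffunE; have [] := hA om.
rewrite leNgt => /negP[]; apply: le_lt_trans pos.
rewrite /robust_value set_cost0 add0r -[leRHS](mulr0 lam); apply: ler_wpM2l.
  exact: le_trans ler01 lam_ge1.
apply: max_cost_le => // om Oom; rewrite ffunE; have [_ ->] := hA om.
by have := none om; rewrite Oom /= leNgt => ->.
Qed.

(** Take a scenario of positive optimum. The outputs of both algorithms are feasible for it, so they
    cost at least its optimum; and a maximal member [B] of [M] containing it is nonempty, with
    [#|B| <= p * #|B|]. *)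
Lemma ratios_ge1 : 0 < robust_opt Omega lam -> [/\ 1 <= p, 1 <= alpha_off & 1 <= alpha_on].
Proof.
case/robust_opt_gt0 => om Oom pos; split.
- have omM : om \in M by move: Oom; rewrite inE => /andP[].
  have [B mB sB] : {B | maxset (fun B => (B \in M) && (B \subset [set: 'I_n])) B & om \subset B}.
    by apply: maxset_exists; rewrite omM subsetT.
  have := M_sys.2 _ _ _ mB mB; rewrite -{1}(mul1r #|B|%:R) ler_pM2r // ltr0n.
  apply: leq_trans (subset_leq_card sB); rewrite card_gt0.
  apply: contraTneq pos => ->; rewrite -leNgt.
  rewrite -[leRHS](set_cost0 C); apply: opt_aug_le; exact: satisfies_set0.
- have [A hA cA] := off set0 om.
  have := le_trans (opt_aug_le hA) cA.
  by rewrite -{1}(mul1r (opt_aug om set0)) ler_pM2r.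
- have := g_comp (enum om); have -> : [set i in enum om] = om.
    by apply/setP => i; rewrite inE mem_enum.
  have gom : satisfies (set0 :|: g (enum om)) om.
    rewrite set0U; apply: satisfies_subr (g_sat (enum om)) _.
    by apply/subsetP => i; rewrite inE mem_enum.
  move/(le_trans (opt_aug_le gom)).
  by rewrite -[X in X <= _](mul1r (opt_aug om set0)) ler_pM2r.
Qed.

Lemma omega_augment theta om : 0 <= theta -> 0 <= p -> om \in Omega ->
  opt_aug om (g (sol theta)) <= (p + 2) * theta.
Proof.
move=> t0 p0; rewrite inE => /andP[omM omK].
apply: (greedy_augment t0 w_ge0 offline_satT g_sat g_mono M_sys p0 omM).
- by move=> e om_e; exact: (knapsack_fits (C:=C) w_ge0 omK om_e).
- exact: (knapsack_weight (C:=C) w_ge0 omK).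
- exact: (phases_small M b t0 w_ge0 g_mono).
Qed.

(** The value is at most [alpha_off * (p + 2)] times the score, where [p + 2 <= 2 * (p + 1)], and
    the best score is at most [16 * (q + 1) * alpha_on] times the optimum; hence 32. *)
Theorem robust_ratio theta (Ew : {ffun {set 'I_n} -> {set 'I_m}}) :
  best_threshold = Some theta ->
  (forall om, om \in Omega -> set_cost (Ew om) <= alpha_off * opt_aug om (g (sol theta))) ->
  robust_value Omega lam (g (sol theta)) Ew <=
    32 * ((p + 1) * (q%:R + 1) * alpha_off * alpha_on) * robust_opt Omega lam.
Proof.
have [th [-> th_in th_best]] := best_thresholdP => -[<-{theta}] cEw.
have th0 := thresholds_ge0 th_in.
have lam0 : 0 <= lam by exact: le_trans ler01 lam_ge1.
have [E0 [Es [feas val]]] := robust_opt_attained.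
pose T := \big[Order.max/0]_(om in Omega) set_cost (Es om).
have T0 : 0 <= T := max_cost_ge0 Es.
have E00 := set_cost_ge0 E0.
have {}val : set_cost E0 + lam * T = robust_opt Omega lam by [].
have lower z t : z \in thresholds costs ->
    (forall D : {set 'I_m}, z < set_cost D -> t <= set_cost D) ->
  exists N : nat, opt [set i in sol z] <= set_cost E0 + N%:R * ((4 * q%:R + 1) * T) /\
    N%:R * t <= bought g (sol z).
  move=> z_in.
  apply: (phases_lower (Es := Es) w_ge0 g_mono M_sys.1 T0).
    by move=> om; apply: (forall_inP feas).
  by move=> om; exact: le_max_cost.
have cost_th : set_cost (g (sol th)) <= score th.
  by rewrite lerDl mulr_ge0.
(* For optimum 0 the ratios may be arbitrary reals, even negative. Here [E0] and [T] cost nothing,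
   so the ratios are only ever multiplied by 0. *)
have [opt0|pos] := leP (robust_opt Omega lam) 0.
  have lamT : 0 <= lam * T by rewrite mulr_ge0.
  have cE0 : set_cost E0 = 0 by apply/eqP; rewrite eq_le E00 andbT; lra.
  have TT : T = 0.
    apply/eqP; rewrite eq_le T0 andbT; apply: le_trans (_ : lam * T <= 0); last lra.
    by rewrite -{1}(mul1r T) ler_wpM2r.
  have [z [z_in z_le z_D]] := threshold_near (lexx 0).
  have z0 := thresholds_ge0 z_in.
  have [N [optN _]] := lower z 0 z_in z_D.
  have {optN}opt_z : opt [set i in sol z] = 0.
    apply/eqP; rewrite eq_le opt_aug_ge0 andbT.
    by move: optN; rewrite cE0 TT !mulr0 addr0.
  have := g_comp (sol z); rewrite opt_z mulr0 => bz.
  have sz : score z <= 0.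
    have z_eq0 : z = 0 by apply/eqP; rewrite eq_le z0 andbT -[leRHS](mulr0 2).
    by rewrite /score [X in lam * X]z_eq0 mulr0 addr0.
  have value0 : robust_value Omega lam (g (sol th)) Ew <= 0.
    rewrite /robust_value -[leRHS]addr0; apply: lerD.
      by apply: le_trans cost_th _; apply: le_trans (th_best z z_in) sz.
    rewrite -[leRHS](mulr0 lam) ler_wpM2l // max_cost_le // => om Oom.
    apply: le_trans (cEw om Oom) _.
    rewrite (_ : opt_aug om _ = 0) ?mulr0 //; apply/eqP; rewrite eq_le opt_aug_ge0 andbT.
    apply: le_trans (opt_aug_le (A := E0 :|: Es om) _) _.
      by apply: satisfies_sub (subsetUr _ _); exact: (forall_inP feas).
    by apply: le_trans (set_costU _ _) _; rewrite cE0 add0r -TT; exact: le_max_cost.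
  apply: le_trans value0 _.
  by rewrite (_ : robust_opt Omega lam = 0) ?mulr0 // -val cE0 TT mulr0 addr0.
have [p1 off1 on1] := ratios_ge1 pos.
pose Q : R := 4 * q%:R + 1.
have q0 : 0 <= (q%:R : R) by rewrite ler0n.
have Q0 : 0 < Q by rewrite /Q; lra.
have on0 : 0 <= alpha_on by lra.
pose t := 2 * (alpha_on * (Q * T)).
have t0 : 0 <= t by rewrite !mulr_ge0 // ltW.
have [z [z_in z_le z_D]] := threshold_near t0.
have [N [optN NT]] := lower z t z_in z_D.
(* With [t = 2 * alpha_on * Q * T], competitiveness bounds the online cost by
   [alpha_on * set_cost E0 + N * t / 2], and [N * t / 2] is at most half of the online cost
   itself. *)
have bz : bought g (sol z) <= 2 * (alpha_on * set_cost E0).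
  have := le_trans (g_comp (sol z)) (ler_wpM2l on0 optN).
  rewrite -/Q mulrDr (_ : alpha_on * (N%:R * (Q * T)) = N%:R * t / 2); last by rewrite /t; field.
  lra.
(* The first stage contributes [2 * alpha_on * set_cost E0], and [z <= 2 * t] contributes
   [4 * (4 * q + 1) * alpha_on * lam * T]. *)
have score_th : score th <= 16 * (q%:R + 1) * alpha_on * robust_opt Omega lam.
  apply: le_trans (th_best z z_in) _.
  have cE : 0 <= q%:R * (alpha_on * set_cost E0) by rewrite !mulr_ge0.
  have cE' : 0 <= alpha_on * set_cost E0 by rewrite !mulr_ge0.
  have lT : 0 <= alpha_on * (lam * T) by rewrite !mulr_ge0.
  have lz : lam * z <= lam * (2 * t) by rewrite ler_wpM2l.
  have -> : 16 * (q%:R + 1) * alpha_on * robust_opt Omega lam =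
    16 * (q%:R * (alpha_on * set_cost E0)) + 16 * (alpha_on * set_cost E0) +
    lam * (2 * t) + 12 * (alpha_on * (lam * T)).
    by rewrite -val /t /Q; ring.
  by rewrite /score; lra.
have off0 : 0 <= alpha_off by lra.
have factor : 1 <= alpha_off * (p + 2).
  by apply: mulr_ege1 => //; lra.
apply: (@le_trans _ _ (alpha_off * (p + 2) * score th)).
  rewrite mulrDr; apply: lerD.
    by rewrite -[leLHS]mul1r ler_wpM2r // set_cost_ge0.
  rewrite mulrCA; apply: ler_wpM2l => //; apply: max_cost_le => [|om Oom].
    by rewrite !mulr_ge0 //; lra.
  apply: le_trans (cEw om Oom) _; rewrite -mulrA; apply: ler_wpM2l => //.
  by apply: omega_augment => //; lra.
have fac0 : 0 <= alpha_off * (p + 2) by lra.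
apply: le_trans (ler_wpM2l fac0 score_th) _.
have nn : 0 <= (q%:R + 1) * alpha_off * alpha_on * robust_opt Omega lam.
  by rewrite !mulr_ge0 ?addr_ge0 // ltW.
have nnp : 0 <= p * ((q%:R + 1) * alpha_off * alpha_on * robust_opt Omega lam).
  by rewrite mulr_ge0 //; lra.
by move: nn nnp; lra.
Qed.

End Selection.

(** * Programs for the basic subroutines *)

Definition Call (P : prog) (args : seq prog) : prog := Seq (Tup args) P.
Definition Zero : prog := Op BAdd (Basic BNil) (Basic BNil).
Definition Not (e : prog) : prog := If e (Basic BNil) True_.

Arguments Var : simpl never.

Ltac pev_rule :=
  lazymatch goal with
  | |- pev (Var _) _ _ => apply: pev_var
  | |- pev (Fst _) _ _ => apply: pev_fst
  | |- pev (Snd _) _ _ => apply: pev_snd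
  | |- pev (Op _ _ _) _ _ => apply: pev_op
  | |- pev (Pair _ _) _ _ => apply: pev_pair
  | |- pev (Basic BNil) _ _ => apply: pev_nil
  | |- pev (Basic BOne) _ _ => apply: pev_one
  | |- pev (Basic BId) _ _ => apply: pev_id
  | |- pev (If _ _ _) _ _ => apply: pev_if
  | |- pev True_ _ _ => apply: pev_pair
  | |- pev Zero _ _ => apply: pev_op
  end.
Ltac pev_path := apply: pev_ext; [by repeat pev_rule | by []].

Tactic Notation "name_ctx" ident(c) :=
  lazymatch goal with |- @pev _ ?x _ _ _ => pose c := x end.

Section Subroutines.
Variable R : realType.
Implicit Types c : ctx R.

Lemma pev_true c (env : c -> data R) : pev True_ env (fun=> enc_bool R true).
Proof. exact: pev_pair (pev_nil _) (pev_nil _). Qed.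

Lemma pev_zero c (env : c -> data R) : pev Zero env (fun=> Num 0).
Proof. by apply: pev_ext (pev_op _ (pev_nil _) (pev_nil _)) _ => j _ /=; rewrite addr0. Qed.

Lemma pev_not c e (env : c -> data R) (x : c -> bool) :
  pev e env (fun j => enc_bool R (x j)) -> pev (Not e) env (fun j => enc_bool R (~~ x j)).
Proof.
move=> he; apply: pev_ext (pev_if he (pev_nil _) (pev_true _)) _ => j _.
by case: (x j).
Qed.

Lemma pev_leq c e1 e2 (env : c -> data R) (x y : c -> R) :
  pev e1 env (fun j => Num (x j)) -> pev e2 env (fun j => Num (y j)) ->
  pev (Op BLeq e1 e2) env (fun j => enc_bool R (x j <= y j)).
Proof. by move=> h1 h2; exact: pev_op h1 h2. Qed.

Lemma pev_add c e1 e2 (env : c -> data R) (x y : c -> R) :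
  pev e1 env (fun j => Num (x j)) -> pev e2 env (fun j => Num (y j)) ->
  pev (Op BAdd e1 e2) env (fun j => Num (x j + y j)).
Proof. by move=> h1 h2; exact: pev_op h1 h2. Qed.

Lemma pev_sub c e1 e2 (env : c -> data R) (x y : c -> R) :
  pev e1 env (fun j => Num (x j)) -> pev e2 env (fun j => Num (y j)) ->
  pev (Op BSub e1 e2) env (fun j => Num (x j - y j)).
Proof. by move=> h1 h2; exact: pev_op h1 h2. Qed.

Lemma pev_mul c e1 e2 (env : c -> data R) (x y : c -> R) :
  pev e1 env (fun j => Num (x j)) -> pev e2 env (fun j => Num (y j)) ->
  pev (Op BMul e1 e2) env (fun j => Num (x j * y j)).
Proof. by move=> h1 h2; exact: pev_op h1 h2. Qed.

Lemma pev_div c e1 e2 (env : c -> data R) (x y : c -> R) :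
  pev e1 env (fun j => Num (x j)) -> pev e2 env (fun j => Num (y j)) ->
  pev (Op BDiv e1 e2) env (fun j => Num (x j / y j)).
Proof. by move=> h1 h2; exact: pev_op h1 h2. Qed.

(** The index is a unary list; folding over it drops one entry per unit. *)
Definition Nth : prog := Fst (Fold (Var 1) (Var 0) (Snd (Var 1))).

Lemma foldl_iter (T T' : Type) (h : T -> T) (a : T) (s : seq T') :
  foldl (fun x _ => h x) a s = iter (size s) h a.
Proof. by elim: s a => //= x s IH a; rewrite IH -iterS iterSr. Qed.

Lemma enc_natE k : enc_nat R k = enc_seq [seq Nil | _ <- nseq k tt].
Proof. by rewrite map_nseq. Qed.

Lemma pev_nth c (k : c -> nat) (u : forall j, 'I_(k j) -> data R)
    (i : forall j, 'I_(k j)) e1 e2 (env : c -> data R) :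
  pbd k -> pev e1 env (fun j => enc_seq [seq u j x | x <- enum 'I_(k j)]) ->
  pev e2 env (fun j => enc_nat R (i j)) ->
  pev (Call Nth [:: e1; e2]) env (fun j => u j (i j)).
Proof.
move=> hk h1 h2; apply: pev_seq (pev_pair h1 (pev_pair h2 (pev_nil _))) _.
apply: pev_ext (pev_fst (pev_fold (X := fun=> unit) (A := fun=> seq (data R))
   (eX := fun _ _ => Nil) (eA := fun _ a => enc_seq a)
   (s := fun j => nseq (i j) tt)
   (a0 := fun j => [seq u j x | x <- enum 'I_(k j)])
   (step := fun _ a _ => behead a) (Inv := fun _ _ => True) _ _ _ _ _ _)) _ => //.
- apply: pev_ext (pev_var _ _) _ => j _ /=; exact: enc_natE.
- pev_path.
- apply: pbd_le hk _ => j _; rewrite size_nseq; exact: ltnW.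
- apply: pev_ext; first by repeat pev_rule.
  by case=> j [x [|y a]].
- move=> j _; rewrite foldl_iter size_nseq.
  have -> t (l : seq (data R)) : iter t behead l = drop t l.
    by elim: t l => [|t IH] l; rewrite ?drop0 // iterSr IH; case: l => //=; case: t {IH}.
  have -> (l : seq (data R)) t : fst_data (enc_seq (drop t l)) = nth Nil l t.
    by rewrite -[t in RHS]addn0 -nth_drop; case: (drop t l).
  by rewrite (nth_map (i j)) ?size_enum_ord // nth_ord_enum.
Qed.

(** A zipper: the bits before position [i] are moved onto a stack, the next bit is replaced by true,
    and the stack is pushed back. *)
Definition SetAdd : prog :=
  LetIn (Fold (Var 1) (Pair (Basic BNil) (Var 0))
         (Pair (Pair (Fst (Snd (Var 1))) (Fst (Var 1))) (Snd (Snd (Var 1)))))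
    (Fold (Fst (Var 0)) (Pair True_ (Snd (Snd (Var 0)))) (Pair (Var 0) (Var 1))).

Lemma foldl_cons (T : Type) (a s : seq T) : foldl (fun a x => x :: a) a s = rev s ++ a.
Proof. by elim: s a => //= x s IH a; rewrite IH rev_cons cat_rcons. Qed.

Lemma pev_set_add c (k : c -> nat) (S : forall j, {set 'I_(k j)})
    (i : forall j, 'I_(k j)) e1 e2 (env : c -> data R) :
  pbd k -> pev e1 env (fun j => enc_set R (S j)) ->
  pev e2 env (fun j => enc_nat R (i j)) ->
  pev (Call SetAdd [:: e1; e2]) env (fun j => enc_set R (i j |: S j)).
Proof.
move=> hk h1 h2; apply: pev_seq (pev_pair h1 (pev_pair h2 (pev_nil _))) _.
pose bits j := [seq enc_bool R (x \in S j) | x <- enum 'I_(k j)].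
have size_bits j : size (bits j) = k j by rewrite size_map size_enum_ord.
apply: pev_let.
  apply: (pev_fold (X := fun=> unit) (A := fun=> (seq (data R) * seq (data R))%type)
    (eX := fun _ _ => Nil) (eA := fun _ a => Cons (enc_seq a.1) (enc_seq a.2))
    (s := fun j => nseq (i j) tt) (a0 := fun j => ([::], bits j))
    (step := fun _ a _ => (head Nil a.2 :: a.1, behead a.2)) (Inv := fun _ _ => True)) => //.
  - apply: pev_ext (pev_var _ _) _ => j _ /=; exact: enc_natE.
  - pev_path.
  - apply: pbd_le hk _ => j _; rewrite size_nseq; exact: ltnW.
  - apply: pev_ext; first by repeat pev_rule.
    by case=> j [x [a [|y b]]].
have state j t : (t <= k j)%N ->
    iter t (fun a => (head Nil a.2 :: a.1, behead a.2)) ([::], bits j) =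
    (rev (take t (bits j)), drop t (bits j)).
  elim: t => [|t IH] tk /=; first by rewrite take0 drop0.
  rewrite IH ?(ltnW tk) //= (drop_nth Nil) ?size_bits //=.
  by rewrite (take_nth Nil) ?size_bits // rev_rcons.
apply: pev_ext (pev_fold (X := fun=> data R) (A := fun=> seq (data R))
    (eX := fun _ x => x) (eA := fun _ a => enc_seq a)
    (s := fun j => rev (take (i j) (bits j)))
    (a0 := fun j => enc_bool R true :: drop (i j).+1 (bits j))
    (step := fun _ a x => x :: a) (Inv := fun _ _ => True) _ _ _ _ _ _) _ => //.
- apply: pev_ext; first by repeat pev_rule.
  by move=> j _ /=; rewrite foldl_iter size_nseq state ?(ltnW (ltn_ord _)) //= map_id.
- apply: pev_ext; first by repeat (exact: pev_true || pev_rule).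
  move=> j _ /=; rewrite foldl_iter size_nseq state ?(ltnW (ltn_ord _)) //=.
  by rewrite (drop_nth Nil) ?size_bits.
- by apply: pbd_le hk _ => j _; rewrite size_rev size_take size_bits ltn_ord ltnW.
- pev_path.
move=> j _; rewrite foldl_cons revK /enc_set; congr enc_seq.
apply: (@eq_from_nth _ Nil) => [|t].
  rewrite size_cat /= size_take size_drop !size_bits ltn_ord size_map size_enum_ord.
  by rewrite addnS -addSn subnKC.
rewrite size_cat /= size_take size_drop !size_bits ltn_ord addnS -addSn subnKC // => tk.
rewrite nth_cat size_take size_bits ltn_ord.
rewrite (nth_map (i j)) ?size_enum_ord // (nth_ord_enum _ (Ordinal tk)) !inE -val_eqE /=.
have nb u (uk : (u < k j)%N) : nth Nil (bits j) u = enc_bool R (Ordinal uk \in S j).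
  by rewrite (nth_map (i j)) ?size_enum_ord // (nth_ord_enum _ (Ordinal uk)).
case: ltngtP => ti.
- by rewrite nth_take // nb.
- rewrite -[(t - i j)%N]prednK ?subn_gt0 //= nth_drop -subnS subnKC // nb.
- by have -> : (t - i j)%N = 0%N by rewrite ti subnn.
Qed.

Definition Rev : prog := Fold (Var 0) (Basic BNil) (Pair (Var 0) (Var 1)).

Lemma pev_rev c (X : c -> Type) (eX : forall j, X j -> data R) (s : forall j, seq (X j))
    e (env : c -> data R) :
  pbd (fun j => size (s j)) ->
  pev e env (fun j => enc_seq [seq eX j x | x <- s j]) ->
  pev (Call Rev [:: e]) env (fun j => enc_seq [seq eX j x | x <- rev (s j)]).
Proof.
move=> hs h; apply: pev_seq (pev_pair h (pev_nil _)) _.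
apply: pev_ext (pev_fold (X := X) (A := fun j => seq (X j))
    (eX := eX) (eA := fun j a => enc_seq [seq eX j x | x <- a]) (s := s)
    (a0 := fun=> [::]) (step := fun _ a x => x :: a) (Inv := fun _ _ => True)
    _ _ _ _ _ _) _ => //.
- pev_path.
- exact: pev_nil.
- pev_path.
- by move=> j _; rewrite foldl_cons cats0.
Qed.

Definition SetCost : prog :=
  Snd (Fold (Var 1) (Pair (Var 0) Zero)
    (Pair (Snd (Fst (Var 1)))
       (If (Fst (Fst (Var 1))) (Op BAdd (Snd (Var 1)) (Var 0)) (Snd (Var 1))))).

Lemma pev_set_cost c (C : c -> covering R) (F : forall j, {set 'I_(nelt (C j))})
    e1 e2 (env : c -> data R) :
  pbd (fun j => nelt (C j)) -> pev e1 env (fun j => enc_set R (F j)) ->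
  pev e2 env (fun j => enc_vec (@cost R (C j))) ->
  pev (Call SetCost [:: e1; e2]) env (fun j => Num (set_cost (F j))).
Proof.
move=> hk h1 h2; apply: pev_seq (pev_pair h1 (pev_pair h2 (pev_nil _))) _.
pose step j (a : seq bool * R) (e : 'I_(nelt (C j))) :=
  (behead a.1, if head false a.1 then a.2 + cost e else a.2).
apply: pev_ext (pev_snd (pev_fold (X := fun j => 'I_(nelt (C j)))
    (A := fun=> (seq bool * R)%type)
    (eX := fun j e => Num (cost e))
    (eA := fun _ a => Cons (enc_seq [seq enc_bool R x | x <- a.1]) (Num a.2))
    (s := fun j => enum 'I_(nelt (C j)))
    (a0 := fun j => ([seq e \in F j | e <- enum 'I_(nelt (C j))], 0))
    (step := step) (Inv := fun _ _ => True) _ _ _ _ _ _)) _ => //.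
- pev_path.
- apply: pev_ext; first by repeat (exact: pev_zero || pev_rule).
  by move=> j _ /=; rewrite -map_comp.
- by apply: pbd_le hk _ => j _; rewrite size_enum_ord.
- apply: pev_ext; first by repeat pev_rule.
  by case=> j [e [[|[] s] x]].
- move=> j _ /=; congr Num.
  have H s x : foldl (step j) ([seq e \in F j | e <- s], x) s =
      ([::], x + \sum_(e <- s | e \in F j) cost e).
    elim: s x => [|e s IH] x /=; first by rewrite big_nil addr0.
    by rewrite /step /= IH big_cons; case: ifP; rewrite ?addrA.
  by rewrite H add0r /set_cost big_enum_cond; apply: eq_bigl => e.
Qed.

Definition enc_knapsacks n q (w : 'I_q -> 'I_n -> R) (b : 'I_q -> R) : data R :=
  enc_seq [seq Cons (Num (b j)) (enc_vec (w j)) | j <- enum 'I_q].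

Section Knapsacks.
Variables (c : ctx R) (C : c -> covering R) (q : c -> nat).
Variables (w : forall j, 'I_(q j) -> 'I_(nreq (C j)) -> R) (b : forall j, 'I_(q j) -> R).
Hypothesis n_pbd : pbd (fun j => nreq (C j)).
Hypothesis q_pbd : pbd q.

Definition Weight : prog :=
  Fold (Var 0) Zero
    (Op BAdd (Var 1) (Op BDiv (Call Nth [:: Snd (Var 0); Var 3]) (Fst (Var 0)))).

Lemma foldl_add (T : Type) (F : T -> R) s x :
  foldl (fun a j => a + F j) x s = x + \sum_(j <- s) F j.
Proof.
by elim: s x => [|j s IH] x /=; rewrite ?big_nil ?addr0 // IH big_cons addrA.
Qed.

Lemma pev_weight (i : forall j, 'I_(nreq (C j))) e1 e2 (env : c -> data R) :
  pev e1 env (fun j => enc_knapsacks (w (j := j)) (b (j := j))) ->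
  pev e2 env (fun j => enc_nat R (i j)) ->
  pev (Call Weight [:: e1; e2]) env
    (fun j => Num (weight (w (j := j)) (b (j := j)) (i j))).
Proof.
move=> h1 h2; apply: pev_seq (pev_pair h1 (pev_pair h2 (pev_nil _))) _.
apply: pev_ext (pev_fold (X := fun j => 'I_(q j)) (A := fun=> R)
    (eX := fun j l => Cons (Num (b l)) (enc_vec (w l)))
    (eA := fun=> @Num R) (s := fun j => enum 'I_(q j)) (a0 := fun=> 0)
    (step := fun j a l => a + w l (i j) / b l) (Inv := fun _ _ => True)
    _ _ _ _ _ _) _ => //.
- pev_path.
- exact: pev_zero.
- by apply: pbd_le q_pbd _ => j _; rewrite size_enum_ord.
- name_ctx d; apply: pev_add; first by pev_path.
  apply: pev_div; last by pev_path.
  apply: (pev_nth (k := fun k : d => nreq (C (projT1 k)))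
      (u := fun (k : d) x => Num (w (projT2 k).1 x)) (i := fun k : d => i (projT1 k))).
  + exact: pbd_ext n_pbd.
  + pev_path.
  + pev_path.
- by move=> j _; rewrite foldl_add add0r /weight big_enum.
Qed.

Definition Fits : prog :=
  Fold (Var 0) True_
    (And (Var 1) (Op BLeq (Call Nth [:: Snd (Var 0); Var 3]) (Fst (Var 0)))).

Lemma pev_fits (i : forall j, 'I_(nreq (C j))) e1 e2 (env : c -> data R) :
  pev e1 env (fun j => enc_knapsacks (w (j := j)) (b (j := j))) ->
  pev e2 env (fun j => enc_nat R (i j)) ->
  pev (Call Fits [:: e1; e2]) env
    (fun j => enc_bool R (fits (w (j := j)) (b (j := j)) (i j))).
Proof.
move=> h1 h2; apply: pev_seq (pev_pair h1 (pev_pair h2 (pev_nil _))) _.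
apply: pev_ext (pev_fold (X := fun j => 'I_(q j)) (A := fun=> bool)
    (eX := fun j l => Cons (Num (b l)) (enc_vec (w l)))
    (eA := fun=> enc_bool R) (s := fun j => enum 'I_(q j)) (a0 := fun=> true)
    (step := fun j a l => a && (w l (i j) <= b l)) (Inv := fun _ _ => True)
    _ _ _ _ _ _) _ => //.
- pev_path.
- exact: pev_true.
- by apply: pbd_le q_pbd _ => j _; rewrite size_enum_ord.
- name_ctx d; apply: (pev_and (x := fun k : d => (projT2 k).2)
    (y := fun k : d => w (projT2 k).1 (i (projT1 k)) <= b (projT2 k).1)).
    by pev_path.
  apply: (pev_leq (x := fun k : d => w (projT2 k).1 (i (projT1 k)))); last by pev_path.
  apply: (pev_nth (k := fun k : d => nreq (C (projT1 k)))
    (u := fun (k : d) x => Num (w (projT2 k).1 x)) (i := fun k : d => i (projT1 k))).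
  + exact: pbd_ext n_pbd.
  + pev_path.
  + pev_path.
- move=> j _; congr enc_bool.
  have H s x : foldl (fun a l => a && (w l (i j) <= b l)) x s =
      x && all (fun l => w l (i j) <= b l) s.
    by elim: s x => [|l s IH] x /=; rewrite ?andbT // IH andbA.
  rewrite H /fits; apply/allP/forallP => [h l|h l _]; last exact: h.
  by apply: h; rewrite mem_enum.
Qed.

Definition Count : prog := Fold (Var 0) Zero (Op BAdd (Var 1) (Basic BOne)).

Lemma pev_count e (env : c -> data R) :
  pev e env (fun j => enc_knapsacks (w (j := j)) (b (j := j))) ->
  pev (Call Count [:: e]) env (fun j => Num (q j)%:R).
Proof.
move=> h; apply: pev_seq (pev_pair h (pev_nil _)) _.
apply: pev_ext (pev_fold (X := fun j => 'I_(q j)) (A := fun=> R)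
    (eX := fun j l => Cons (Num (b l)) (enc_vec (w l)))
    (eA := fun=> @Num R) (s := fun j => enum 'I_(q j)) (a0 := fun=> 0)
    (step := fun j a l => a + 1) (Inv := fun _ _ => True)
    _ _ _ _ _ _) _ => //.
- pev_path.
- exact: pev_zero.
- by apply: pbd_le q_pbd _ => j _; rewrite size_enum_ord.
- pev_path.
- by move=> j _; rewrite foldl_add add0r big_enum sumr_const card_ord.
Qed.

End Knapsacks.

(** Counting upwards while pushing gives a decreasing list, which is the order in which
    [greedy_step] scans. *)
Definition Range : prog :=
  Fst (Fold (Var 0) (Pair (Basic BNil) (Basic BNil))
    (Pair (Pair (Snd (Var 1)) (Fst (Var 1))) (Pair (Basic BNil) (Snd (Var 1))))).

Lemma pev_range c (n : c -> nat) e (env : c -> data R) : pbd n ->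
  pev e env (fun j => enc_nat R (n j)) ->
  pev (Call Range [:: e]) env
    (fun j => enc_seq [seq enc_nat R (nat_of_ord i) | i <- rev (enum 'I_(n j))]).
Proof.
move=> hn h; apply: pev_seq (pev_pair h (pev_nil _)) _.
apply: pev_ext (pev_fst (pev_fold (X := fun=> unit) (A := fun=> (seq nat * nat)%type)
    (eX := fun _ _ => Nil)
    (eA := fun _ a => Cons (enc_seq [seq enc_nat R i | i <- a.1]) (enc_nat R a.2))
    (s := fun j => nseq (n j) tt) (a0 := fun=> ([::], 0%N))
    (step := fun _ a _ => (a.2 :: a.1, a.2.+1)) (Inv := fun _ _ => True)
    _ _ _ _ _ _)) _ => //.
- apply: pev_ext (pev_var _ _) _ => j _ /=; exact: enc_natE.
- pev_path.
- by apply: pbd_le hn _ => j _; rewrite size_nseq.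
- pev_path.
- move=> j _ /=; rewrite foldl_iter size_nseq.
  have -> t : iter t (fun a => (a.2 :: a.1, a.2.+1)) ([::], 0%N) = (rev (iota 0 t), t).
    elim: t => // t IH; rewrite iterS IH.
    have -> : iota 0 t.+1 = rcons (iota 0 t) t by rewrite -cats1 -addn1 iotaD.
    by rewrite rev_rcons.
  by rewrite -val_enum_ord -map_rev -map_comp.
Qed.

End Subroutines.

(** * The robust algorithm as a program *)

Section FirstStage.
Variables (R : realType) (Aon : prog) (kon : nat).
Implicit Types c : ctx R.

(** Besides the actual input this records [indep] and [onl], which the program reaches only through
    oracle queries and calls of [Aon]; [valid] ties them together. [onl] takes the latest request
    first, hence the reversals. *)
Record problem := Problem {
  inst : instance R;
  nknap : nat;
  kweight : 'I_nknap -> 'I_(nreq inst) -> R;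
  kbound : 'I_nknap -> R;
  infl : R;
  indep : {set {set 'I_(nreq inst)}};
  onl : seq 'I_(nreq inst) -> {set 'I_(nelt inst)} }.

Definition input (x : problem) : data R := enc_robust (@kweight x) (@kbound x) (infl x).

Definition enc_reqs n (r : seq 'I_n) : data R := enc_seq [seq enc_nat R (nat_of_ord i) | i <- r].

Definition valid (O : data R -> bool) (x : problem) : Prop :=
  [/\ membership_oracle (indep x) O,
      forall r e, onl r \subset onl (e :: r) (p := x)
    & forall r, computes (@no_oracle R) kon Aon
        (Cons (enc_inst (inst x)) (enc_reqs (rev r))) (enc_set R (onl r (p := x)))].

Definition over c (pr : c -> problem) : Prop :=
  (forall j, dom j -> valid (@orc R c j) (pr j)) /\ pbd (fun j => data_size (input (pr j))).

Lemma over_ext c (pr : c -> problem) X D :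
  over pr -> over (c := @ext R c X D) (fun k => pr (projT1 k)).
Proof. by case=> hv hs; split; [move=> k [dk _]; exact: hv | exact: pbd_ext hs]. Qed.

Lemma size_enc_seq (s : seq (data R)) : (size s < data_size (enc_seq s))%N.
Proof. by elim: s => //= x s IH; rewrite ltnS (leq_trans IH) // leq_addl. Qed.

Lemma size_enc_seq_le (s : seq (data R)) B : (forall x, List.In x s -> (data_size x <= B)%N) ->
  (data_size (enc_seq s) <= size s * B.+1 + 1)%N.
Proof.
elim: s => //= x s IH h; rewrite mulSn.
have := h x (or_introl erefl); have := IH (fun y hy => h y (or_intror hy)); lia.
Qed.

Section Bounds.
Variables (c : ctx R) (pr : c -> problem).
Hypothesis H : over pr.

Lemma nelt_pbd : pbd (fun j => nelt (inst (pr j))).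
Proof.
apply: pbd_le H.2 _ => j _ /=.
have := size_enc_seq [seq Num (cost i) | i <- enum 'I_(nelt (inst (pr j)))].
rewrite size_map size_enum_ord /enc_vec; lia.
Qed.

Lemma nreq_pbd : pbd (fun j => nreq (inst (pr j))).
Proof.
apply: pbd_le H.2 _ => j _ /=.
have := size_enc_seq (nseq (nreq (inst (pr j))) Nil).
rewrite size_nseq /enc_nat; lia.
Qed.

Lemma nknap_pbd : pbd (fun j => nknap (pr j)).
Proof.
apply: pbd_le H.2 _ => j _ /=.
have := size_enc_seq
  [seq Cons (Num (kbound l)) (enc_vec (kweight l)) | l <- enum 'I_(nknap (pr j))].
rewrite size_map size_enum_ord; lia.
Qed.

(** Requests are unary numbers of size at most [2 * nreq + 1], so only the length of the sequence
    matters. *)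
Lemma query_pbd (r : forall j, seq 'I_(nreq (inst (pr j)))) : pbd (fun j => size (r j)) ->
  pbd (fun j => data_size (Cons (enc_inst (inst (pr j))) (enc_reqs (rev (r j))))).
Proof.
move=> hr.
apply: (pbd_le (h := fun j => data_size (input (pr j)) +
    (size (r j) * (2 * nreq (inst (pr j)) + 2) + 2))%N).
  apply: pbd_add H.2 (pbd_add (pbd_mul hr (pbd_add (pbd_mul (pbd_const _ _) nreq_pbd)
    (pbd_const _ _))) (pbd_const _ _)).
move=> j _.
have := @size_enc_seq_le [seq enc_nat R (nat_of_ord i) | i <- rev (r j)]
  (2 * nreq (inst (pr j)) + 1).
rewrite size_map size_rev => /(_ _)/wrap[]; last first.
  by rewrite /= /enc_reqs; lia.
move=> x; elim: (rev (r j)) => //= i s IH [<-|/IH //].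
have := @size_enc_seq_le (nseq i Nil) 1; rewrite size_nseq => /(_ _)/wrap[].
  by elim: (nat_of_ord i) => //= t IHt y [<-|/IHt].
have := ltn_ord i; rewrite /enc_nat; lia.
Qed.

End Bounds.

Local Notation InstE e := (Fst e).
Local Notation CostsE e := (Fst (Fst e)).
Local Notation NreqE e := (Fst (Snd (Fst e))).
Local Notation KnapsE e := (Fst (Snd e)).
Local Notation InflE e := (Snd (Snd e)).

Definition Online : prog :=
  Seq (Pair (InstE (Var 1)) (Call Rev [:: Var 0])) (strip_queries Aon).

Lemma pev_online c (pr : c -> problem) (r : forall j, seq 'I_(nreq (inst (pr j))))
    e1 e2 (env : c -> data R) :
  over pr -> pbd (fun j => size (r j)) ->
  pev e1 env (fun j => enc_reqs (r j)) -> pev e2 env (fun j => input (pr j)) ->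
  pev (Call Online [:: e1; e2]) env (fun j => enc_set R (onl (r j))).
Proof.
move=> H hr h1 h2; apply: pev_seq (pev_pair h1 (pev_pair h2 (pev_nil _))) _.
apply: (@pev_call _ _ _ _ kon _
    (fun j => Cons (enc_inst (inst (pr j))) (enc_reqs (rev (r j))))).
- apply: pev_pair; first by pev_path.
  apply: (pev_rev (X := fun j => 'I_(nreq (inst (pr j))))
    (eX := fun j i => enc_nat R (nat_of_ord i)) (s := r)) => //.
  by pev_path.
- by move=> j dj; have [_ _] := H.1 j dj; apply.
- exact: query_pbd H r hr.
Qed.

Definition Bought : prog := Call SetCost [:: Call Online [:: Var 0; Var 1]; CostsE (Var 1)].

Lemma pev_bought c (pr : c -> problem) (r : forall j, seq 'I_(nreq (inst (pr j))))
    e1 e2 (env : c -> data R) :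
  over pr -> pbd (fun j => size (r j)) ->
  pev e1 env (fun j => enc_reqs (r j)) -> pev e2 env (fun j => input (pr j)) ->
  pev (Call Bought [:: e1; e2]) env (fun j => Num (bought (onl (p := pr j)) (r j))).
Proof.
move=> H hr h1 h2; apply: pev_seq (pev_pair h1 (pev_pair h2 (pev_nil _))) _.
apply: (pev_set_cost (C := fun j => inst (pr j)) (F := fun j => onl (r j))).
- exact: nelt_pbd H.
- by apply: pev_online => //; pev_path.
- by pev_path.
Qed.

Definition enc_state x (st : state (inst x)) : data R :=
  Cons (Cons (enc_reqs (asked st)) (enc_set R (added st)))
    (Cons (Num (load st)) (Num (paid st))).

(** The loop invariant behind the time bounds: the sequence is no longer than the online solution is
    large, hence has at most |E| entries. *)
Definition good x (st : state (inst x)) : Prop :=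
  paid st = bought (@onl x) (asked st) /\ (size (asked st) <= #|onl (asked st)|)%N.

Definition pick x := pick_best (indep x) (@kweight x) (@kbound x) (@onl x).
Definition step_of x := greedy_step (indep x) (@kweight x) (@kbound x) (@onl x).
Definition greedy_of x := greedy (indep x) (@kweight x) (@kbound x) (@onl x).
Definition phase_of x := phase (indep x) (@kweight x) (@kbound x) (@onl x).
Definition phases_of x := phases (indep x) (@kweight x) (@kbound x) (@onl x).

Definition Query e := Seq e (Basic BQuery).

(* After the four [LetIn]s the environment is
   [:: weight; cost; sequence; set; e; best; st; theta; input]. *)
Definition Pick : prog :=
  LetIn (Call SetAdd [:: Snd (Fst (Var 2)); Var 0])
  (LetIn (Pair (Var 1) (Fst (Fst (Var 3))))
  (LetIn (Call Bought [:: Var 0; Var 6])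
  (LetIn (Call Weight [:: KnapsE (Var 7); Var 3])
  (If (And (And (Not (Call Nth [:: Snd (Fst (Var 6)); Var 4]))
           (And (Call Fits [:: KnapsE (Var 8); Var 4])
           (And (Query (Var 3))
           (And (Op BLeq (Fst (Snd (Var 6))) (Call Count [:: KnapsE (Var 8)]))
                (Op BLeq (Op BMul (Var 7) (Var 0))
                   (Op BMul (Call Count [:: KnapsE (Var 8)])
                      (Op BSub (Var 1) (Snd (Snd (Var 6))))))))))
         (Not (Op BLeq (Var 1) (Snd (Snd (Var 5))))))
     (Pair (Pair (Var 2) (Var 3)) (Pair (Op BAdd (Fst (Snd (Var 6))) (Var 0)) (Var 1)))
     (Var 5))))).

Lemma pev_query c (pr : c -> problem) (S : forall j, {set 'I_(nreq (inst (pr j)))}) e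
    (env : c -> data R) :
  over pr -> pev e env (fun j => enc_set R (S j)) ->
  pev (Query e) env (fun j => enc_bool R (S j \in indep (pr j))).
Proof.
move=> H h; apply: pev_ext (pev_seq h (pev_basic BQuery _)) _ => j dj /=.
by have [-> _ _] := H.1 j dj.
Qed.

Lemma pev_pick c (pr : c -> problem) (st best : forall j, state (inst (pr j)))
    (e : forall j, 'I_(nreq (inst (pr j)))) (theta : c -> R) (rest : c -> data R) :
  over pr -> pbd (fun j => size (asked (st j))) ->
  pev Pick
    (fun j => Cons (enc_nat R (e j)) (Cons (enc_state (best j)) (Cons (enc_state (st j))
       (Cons (Num (theta j)) (Cons (input (pr j)) (rest j))))))
    (fun j => enc_state (pick (theta j) (st j) (best j) (e j))).
Proof.
move=> H hst.
have hn := nreq_pbd H; have hq := nknap_pbd H.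
apply: pev_let.
  by apply: (pev_set_add (k := fun j => nreq (inst (pr j)))
    (S := fun j => added (st j)) (i := e)) => //; pev_path.
apply: pev_let; first by pev_path.
apply: (pev_let (u := fun j => Num (bought (onl (p := pr j)) (e j :: asked (st j))))).
  apply: (pev_bought (r := fun j => e j :: asked (st j))) => //; try pev_path.
  by apply: pbd_le (pbd_add hst (pbd_const c 1)) _ => j _; rewrite addn1.
apply: pev_let.
  by apply: (pev_weight (C := fun j => inst (pr j)) (w := fun j => @kweight (pr j))
    (b := fun j => @kbound (pr j)) hn hq (i := e)); pev_path.
have hcount e1 env : pev e1 env (fun j => enc_knapsacks (@kweight (pr j)) (@kbound (pr j))) ->
    pev (Call Count [:: e1]) env (fun j => Num (nknap (pr j))%:R).
  exact: (pev_count (C := fun j => inst (pr j)) (w := fun j => @kweight (pr j))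
    (b := fun j => @kbound (pr j)) hq).
apply: pev_ext.
  apply: pev_if.
  - apply: pev_and; first last.
      by apply: pev_not; apply: (pev_leq
        (x := fun j => bought (onl (p := pr j)) (e j :: asked (st j)))
        (y := fun j => paid (best j))); pev_path.
    apply: pev_and.
      apply: pev_not; apply: (pev_nth (k := fun j => nreq (inst (pr j)))
        (u := fun j x => enc_bool R (x \in added (st j))) (i := e)) => //; pev_path.
    apply: pev_and.
      apply: (pev_fits (C := fun j => inst (pr j)) (w := fun j => @kweight (pr j))
        (b := fun j => @kbound (pr j)) hn hq (i := e)); pev_path.
    apply: pev_and.
      by apply: (pev_query (S := fun j => e j |: added (st j))) => //; pev_path.
    apply: pev_and.
      apply: (pev_leq (x := fun j => load (st j))); first by pev_path.
      by apply: hcount; pev_path.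
    apply: (pev_leq (x := fun j => theta j * weight (@kweight (pr j)) (@kbound (pr j)) (e j))).
      by apply: pev_mul; pev_path.
    apply: pev_mul; first by apply: hcount; pev_path.
    apply: (pev_sub (x := fun j => bought (onl (p := pr j)) (e j :: asked (st j)))
      (y := fun j => paid (st j))); pev_path.
  - apply: pev_pair; first by pev_path.
    apply: pev_pair; last by pev_path.
    by apply: (pev_add (x := fun j => load (st j))); pev_path.
  - by pev_path.
move=> j _; rewrite /pick /pick_best /admissible; case: ifP => //=.
  by move=> h; case: ifP h => // ->.
by move=> h; case: ifP h => // ->.
Qed.

Definition GreedyStep : prog := Fold (Call Range [:: NreqE (Var 2)]) (Var 0) Pick.

Lemma pev_greedy_step c (pr : c -> problem) (st : forall j, state (inst (pr j)))
    (theta : c -> R) e1 e2 e3 (env : c -> data R) :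
  over pr -> pbd (fun j => size (asked (st j))) ->
  pev e1 env (fun j => enc_state (st j)) -> pev e2 env (fun j => Num (theta j)) ->
  pev e3 env (fun j => input (pr j)) ->
  pev (Call GreedyStep [:: e1; e2; e3]) env (fun j => enc_state (step_of (theta j) (st j))).
Proof.
move=> H hst h1 h2 h3.
apply: pev_seq (pev_pair h1 (pev_pair h2 (pev_pair h3 (pev_nil _)))) _.
apply: (pev_fold (X := fun j => 'I_(nreq (inst (pr j)))) (A := fun j => state (inst (pr j)))
  (eX := fun j i => enc_nat R (nat_of_ord i)) (eA := fun j => @enc_state (pr j))
  (s := fun j => rev (enum 'I_(nreq (inst (pr j))))) (a0 := st)
  (step := fun j => pick (theta j) (st j)) (Inv := fun _ _ => True)) => //.
- by apply: (pev_range (n := fun j => nreq (inst (pr j))) (nreq_pbd H)); pev_path.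
- pev_path.
- by apply: pbd_le (nreq_pbd H) _ => j _; rewrite size_rev size_enum_ord.
- name_ctx d; apply: (@pev_pick d (fun k : d => pr (projT1 k))
    (fun k : d => st (projT1 k)) (fun k : d => (projT2 k).2)
    (fun k : d => (projT2 k).1) (fun k : d => theta (projT1 k)) (fun=> Nil));
    [exact: over_ext | exact: pbd_ext hst].
Qed.

Lemma good_step x (theta : R) (st : state (inst x)) :
  (forall r e, onl r \subset onl (e :: r) (p := x)) -> good st -> good (step_of theta st).
Proof.
move=> mono gst; rewrite /step_of.
have [_ [->//|[e [_ -> lt]]]] :=
  greedy_stepP (indep x) (@kweight x) (@kbound x) (@onl x) theta st.
case: gst => hp hs; split=> //=.
by rewrite (leq_ltn_trans hs) // (card_bought mono) // -hp.
Qed.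

Definition Greedy : prog :=
  Fold (NreqE (Var 2))
    (Pair (Pair (Var 0) (NreqE (Var 2))) (Pair Zero (Call Bought [:: Var 0; Var 2])))
    (Call GreedyStep [:: Var 1; Var 3; Var 4]).

Lemma size_onl x r : (size r <= #|onl r (p := x)|)%N -> (size r <= nelt (inst x))%N.
Proof. by move/leq_trans; apply; rewrite -[leqRHS]card_ord max_card. Qed.

(** False is encoded by [Nil], so the unary [n] in the input doubles as the empty set of requests,
    with which [Greedy] starts. *)
Lemma enc_set0 n : enc_set R (set0 : {set 'I_n}) = enc_nat R n.
Proof.
rewrite /enc_set /enc_nat -[in RHS](size_enum_ord n); congr enc_seq.
by elim: (enum _) => //= i s ->; rewrite inE.
Qed.

Lemma pev_greedy c (pr : c -> problem) (r : forall j, seq 'I_(nreq (inst (pr j))))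
    (theta : c -> R) (rest : c -> data R) :
  over pr -> (forall j, dom j -> size (r j) <= #|onl (r j)|)%N ->
  pev Greedy
    (fun j => Cons (enc_reqs (r j)) (Cons (Num (theta j)) (Cons (input (pr j)) (rest j))))
    (fun j => enc_state (greedy_of (theta j) (r j))).
Proof.
move=> H hr.
have rb : pbd (fun j => size (r j)).
  by apply: pbd_le (nelt_pbd H) _ => j dj; apply: size_onl; exact: hr.
apply: pev_ext (pev_fold (X := fun=> unit) (A := fun j => state (inst (pr j)))
  (eX := fun _ _ => Nil) (eA := fun j => @enc_state (pr j))
  (s := fun j => nseq (nreq (inst (pr j))) tt)
  (a0 := fun j => start (@onl (pr j)) (r j))
  (step := fun j a _ => step_of (theta j) a) (Inv := fun j => @good (pr j))
  _ _ _ _ _ _) _.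
- by apply: pev_ext; [repeat pev_rule | move=> j _ /=; rewrite -enc_natE].
- apply: pev_ext.
    apply: pev_pair; first by repeat pev_rule.
    apply: pev_pair; first exact: pev_zero.
    by apply: (pev_bought H rb); pev_path.
  by move=> j _; rewrite /enc_state /= enc_set0.
- by apply: pbd_le (nreq_pbd H) _ => j _; rewrite size_nseq.
- by move=> j dj; split=> //=; exact: hr.
- by move=> j a _ dj; apply: good_step; have [] := H.1 j dj.
- name_ctx d; apply: (pev_greedy_step (c := d) (pr := fun k : d => pr (projT1 k))
    (st := fun k : d => (projT2 k).2) (theta := fun k : d => theta (projT1 k))).
  + exact: over_ext.
  + apply: (pbd_le (h := fun k : d => nelt (inst (pr (projT1 k))))).
      exact: pbd_ext (nelt_pbd H).
    by move=> k [_ [_ hk]]; exact: size_onl hk.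
  + pev_path.
  + pev_path.
  + pev_path.
- by move=> j _; rewrite foldl_iter size_nseq.
Qed.

Definition Phase : prog :=
  LetIn Greedy
    (If (Op BLeq (Op BSub (Snd (Snd (Var 0))) (Call Bought [:: Var 1; Var 3])) (Var 2))
       (Var 1) (Fst (Fst (Var 0)))).

Lemma pev_phase c (pr : c -> problem) (r : forall j, seq 'I_(nreq (inst (pr j))))
    (theta : c -> R) e1 e2 e3 (env : c -> data R) :
  over pr -> (forall j, dom j -> size (r j) <= #|onl (r j)|)%N ->
  pev e1 env (fun j => enc_reqs (r j)) -> pev e2 env (fun j => Num (theta j)) ->
  pev e3 env (fun j => input (pr j)) ->
  pev (Call Phase [:: e1; e2; e3]) env (fun j => enc_reqs (phase_of (theta j) (r j))).
Proof.
move=> H hr h1 h2 h3.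
apply: pev_seq (pev_pair h1 (pev_pair h2 (pev_pair h3 (pev_nil _)))) _.
have rb : pbd (fun j => size (r j)).
  by apply: pbd_le (nelt_pbd H) _ => j dj; apply: size_onl; exact: hr.
apply: pev_let; first exact: pev_greedy.
apply: pev_ext.
  apply: pev_if.
  - apply: (pev_leq (x := fun j => paid (greedy_of (theta j) (r j)) - bought (@onl (pr j)) (r j))
      (y := theta)); last by pev_path.
    apply: (pev_sub (x := fun j => paid (greedy_of (theta j) (r j)))); first by pev_path.
    by apply: (pev_bought H rb); pev_path.
  - by pev_path.
  - by pev_path.
by move=> j _; rewrite /phase_of /phase /=; case: ifP; case: ifP.
Qed.

Lemma good_greedy x (theta : R) (r : seq 'I_(nreq (inst x))) k :
  (forall r e, onl r \subset onl (e :: r) (p := x)) -> (size r <= #|onl r|)%N ->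
  good (iter k (step_of theta) (start (@onl x) r)).
Proof. by move=> mono hr; elim: k => [|k IH] //=; exact: good_step. Qed.

Lemma size_phase x (theta : R) (r : seq 'I_(nreq (inst x))) :
  (forall r e, onl r \subset onl (e :: r) (p := x)) -> (size r <= #|onl r|)%N ->
  (size (phase_of theta r) <= #|onl (phase_of theta r)|)%N.
Proof.
move=> mono hr; rewrite /phase_of /phase; case: ifP => // _.
by have [] := good_greedy theta (nreq (inst x)) mono hr.
Qed.

(** The list of costs serves as a counter of |E| rounds. *)
Definition Phases : prog :=
  Fold (CostsE (Var 1)) (Basic BNil) (Call Phase [:: Var 1; Var 2; Var 3]).

Lemma pev_phases c (pr : c -> problem) (theta : c -> R) e1 e2 (env : c -> data R) :
  over pr -> pev e1 env (fun j => Num (theta j)) -> pev e2 env (fun j => input (pr j)) ->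
  pev (Call Phases [:: e1; e2]) env
    (fun j => enc_reqs (phases_of (pr j) (theta j))).
Proof.
move=> H h1 h2; apply: pev_seq (pev_pair h1 (pev_pair h2 (pev_nil _))) _.
apply: pev_ext (pev_fold (X := fun j => 'I_(nelt (inst (pr j))))
  (A := fun j => seq 'I_(nreq (inst (pr j))))
  (eX := fun j i => Num (cost i)) (eA := fun j r => enc_reqs r)
  (s := fun j => enum 'I_(nelt (inst (pr j)))) (a0 := fun=> [::])
  (step := fun j a _ => phase_of (theta j) a)
  (Inv := fun j r => (size r <= #|onl r|)%N) _ _ _ _ _ _) _.
- pev_path.
- exact: pev_nil.
- by apply: pbd_le (nelt_pbd H) _ => j _; rewrite size_enum_ord.
- by [].
- by move=> j a _ dj; apply: size_phase; have [] := H.1 j dj.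
- name_ctx d; apply: (pev_phase (c := d) (pr := fun k : d => pr (projT1 k))
    (r := fun k : d => (projT2 k).2) (theta := fun k : d => theta (projT1 k))).
  + exact: over_ext.
  + by move=> k [].
  + pev_path.
  + pev_path.
  + pev_path.
- by move=> j _; rewrite foldl_iter size_enum_ord.
Qed.

Lemma size_phases x (theta : R) :
  (forall r e, onl r \subset onl (e :: r) (p := x)) ->
  (size (phases_of x theta) <= #|onl (phases_of x theta)|)%N.
Proof.
move=> mono; rewrite /phases_of /phases.
suff H k : (size (iter k (@phase_of x theta) [::]) <= #|onl (iter k (@phase_of x theta) [::])|)%N.
  exact: H.
by elim: k => [|k IH] //=; exact: size_phase.
Qed.

(** Both loops run over the costs, the inner one only to count. After the [LetIn] the environment is
    [:: next multiple; counter entry; accumulator; cost; list so far; input]. *)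
Definition Thresholds : prog :=
  Fold (CostsE (Var 0)) (Pair Zero (Basic BNil))
    (Fst (Fold (CostsE (Var 2)) (Pair (Var 1) Zero)
       (LetIn (Op BAdd (Snd (Var 1)) (Var 2))
          (Pair (Pair (Var 0) (Fst (Var 2))) (Var 0))))).

Definition costs x : seq R := [seq cost e | e <- enum 'I_(nelt (inst x))].

Lemma size_costs x : size (costs x) = nelt (inst x).
Proof. by rewrite size_map size_enum_ord. Qed.

Lemma size_multiples (x : R) s l : size (multiples x s l).1 = (size s + size l)%N.
Proof.
rewrite /multiples; elim/last_ind: s => [|s y IH] //.
by rewrite foldl_rcons /= IH size_rcons.
Qed.

Lemma size_thresholds (s : seq R) : size (thresholds s) = (size s * size s + 1)%N.
Proof.
rewrite /thresholds; suff H s1 : size (foldl (fun l x => (multiples x s l).1) [:: 0] s1) =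
    (size s1 * size s + 1)%N by exact: H.
elim/last_ind: s1 => [|s1 y IH] //.
by rewrite foldl_rcons size_multiples IH size_rcons; lia.
Qed.

Lemma pev_thresholds c (pr : c -> problem) e (env : c -> data R) :
  over pr -> pev e env (fun j => input (pr j)) ->
  pev (Call Thresholds [:: e]) env
    (fun j => enc_seq [seq Num x | x <- thresholds (costs (pr j))]).
Proof.
move=> H h; apply: pev_seq (pev_pair h (pev_nil _)) _.
have costs_pbd : pbd (fun j => size (costs (pr j))).
  by apply: pbd_le (nelt_pbd H) _ => j _; rewrite size_costs.
have encE x : enc_vec (@cost R (inst x)) = enc_seq [seq Num z | z <- costs x].
  by rewrite /costs -map_comp.
apply: (pev_fold (X := fun=> R) (A := fun=> seq R) (eX := fun _ x => Num x)
  (eA := fun _ l => enc_seq [seq Num x | x <- l])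
  (s := fun j => costs (pr j)) (a0 := fun=> [:: 0])
  (step := fun j l x => (multiples x (costs (pr j)) l).1) (Inv := fun _ _ => True)) => //.
- by apply: pev_ext; [repeat pev_rule | move=> j _ /=; rewrite encE].
- exact: pev_pair (pev_zero _) (pev_nil _).
- name_ctx d; apply: (pev_ext (pev_fst (pev_fold (c := d) (X := fun=> R)
    (A := fun=> (seq R * R)%type) (eX := fun _ x => Num x)
    (eA := fun _ a => Cons (enc_seq [seq Num x | x <- a.1]) (Num a.2))
    (s := fun k : d => costs (pr (projT1 k))) (a0 := fun k : d => ((projT2 k).2, 0))
    (step := fun (k : d) a _ => (a.2 + (projT2 k).1 :: a.1, a.2 + (projT2 k).1))
    (Inv := fun _ _ => True) _ _ _ _ _ _))) => //.
  + by apply: pev_ext; [repeat pev_rule | move=> k _ /=; rewrite encE].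
  + by apply: pev_pair; [pev_path | exact: pev_zero].
  + exact: pbd_ext costs_pbd.
  + name_ctx f; apply: (pev_let
      (u := fun k : f => Num ((projT2 k).2.2 + (projT2 (projT1 k)).1))); pev_path.
Qed.

Definition score_of x := score (indep x) (@kweight x) (@kbound x) (@onl x) (infl x).
Definition best_of x := best_threshold (indep x) (@kweight x) (@kbound x) (@onl x) (infl x).

(** A threshold is represented by its first-stage set and its score, so the output is at hand when
    the loop ends. *)
Definition enc_best x (a : option R) : data R :=
  if a is Some theta then
    Cons (enc_set R (onl (phases_of x theta))) (Num (score_of x theta))
  else Nil.

(* In the body the environment is [:: candidate; sequence; theta; best; input]. *)
Definition Best : prog :=
  Fold (Call Thresholds [:: Var 0]) (Basic BNil)
    (LetIn (Call Phases [:: Var 0; Var 2])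
    (LetIn (Pair (Call Online [:: Var 0; Var 3])
            (Op BAdd (Call Bought [:: Var 0; Var 3]) (Op BMul (InflE (Var 3)) (Var 1))))
    (If (Var 3) (If (Op BLeq (Snd (Var 3)) (Snd (Var 0))) (Var 3) (Var 0)) (Var 0)))).

Lemma pev_best c (pr : c -> problem) e (env : c -> data R) :
  over pr -> pev e env (fun j => input (pr j)) ->
  pev (Call Best [:: e]) env (fun j => enc_best (pr j) (best_of (pr j))).
Proof.
move=> H h; apply: pev_seq (pev_pair h (pev_nil _)) _.
apply: (pev_fold (X := fun=> R) (A := fun=> option R) (eX := fun _ x => Num x)
  (eA := fun j => enc_best (pr j)) (s := fun j => thresholds (costs (pr j)))
  (a0 := fun=> None)
  (step := fun j => keep_best (indep (pr j)) (@kweight (pr j)) (@kbound (pr j))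
     (@onl (pr j)) (infl (pr j))) (Inv := fun _ _ => True)) => //.
- by apply: pev_thresholds => //; pev_path.
- exact: pev_nil.
- apply: (pbd_le (h := fun j => (nelt (inst (pr j)) * nelt (inst (pr j)) + 1)%N)).
    exact: pbd_add (pbd_mul (nelt_pbd H) (nelt_pbd H)) (pbd_const _ _).
  by move=> j _; rewrite size_thresholds size_costs.
- name_ctx d.
  have Hd : over (c := d) (fun k : d => pr (projT1 k)) by exact: over_ext.
  have sb : pbd (fun k : d => size (phases_of (pr (projT1 k)) (projT2 k).1)).
    apply: (pbd_le (h := fun k : d => nelt (inst (pr (projT1 k))))); first exact: nelt_pbd Hd.
    move=> k dk; apply/size_onl/size_phases; by have [] := Hd.1 k dk.
  apply: pev_let.
    by apply: (pev_phases (pr := fun k : d => pr (projT1 k))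
      (theta := fun k : d => (projT2 k).1) Hd); pev_path.
  apply: (pev_let (u := fun k : d => enc_best (pr (projT1 k)) (Some (projT2 k).1))).
    apply: pev_pair.
      by apply: (pev_online Hd sb); pev_path.
    apply: pev_add; first by apply: (pev_bought Hd sb); pev_path.
    by apply: pev_mul; pev_path.
  apply: pev_ext; first by repeat pev_rule.
  move=> [j [x [a|]]] _ //=; rewrite /keep_best -/(score_of (pr j)).
  by case: (score_of _ a <= score_of _ x).
Qed.

Definition First : prog := Fst (Call Best [:: Basic BId]).

Lemma pev_first c (pr : c -> problem) : over pr ->
  pev First (fun j => input (pr j)) (fun j => fst_data (enc_best (pr j) (best_of (pr j)))).
Proof. by move=> H; apply: pev_fst (pev_best H (pev_id _)). Qed.

End FirstStage.

(** * The augmentation procedure and the final assembly *)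

Definition Second (Aoff : prog) : prog :=
  Seq (Pair (Seq (Basic BFst) (Basic BFst)) (Basic BSnd)) (strip_queries Aoff).

Lemma runs_second (R : realType) (O : data R -> bool) (Aoff : prog) k v inp z y :
  computes (@no_oracle R) k Aoff (Cons v z) y ->
  runs O (Second Aoff) (Cons (Cons v inp) z) y
    (10 + k * data_size (Cons (Cons v inp) z) ^ k)%N.
Proof.
case=> t ht lt.
have call : runs O (strip_queries Aoff) (Cons v z) y t.
  by exists t => //; exact: run_strip_queries.
have args : runs O (Pair (Seq (Basic BFst) (Basic BFst)) (Basic BSnd))
    (Cons (Cons v inp) z) (Cons v z) 5.
  exact: runs_pair (runs_seq (runs_basic O BFst _) (runs_basic O BFst _)) (runs_basic O BSnd _).
apply: runs_le (runs_seq args call) _.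
have le_size : (data_size (Cons v z) <= data_size (Cons (Cons v inp) z))%N by rewrite /=; lia.
have le_exp : (data_size (Cons v z) ^ k <= data_size (Cons (Cons v inp) z) ^ k)%N.
  by case: (k) => // k'; rewrite leq_exp2r.
by have := leq_mul (leqnn k) le_exp; lia.
Qed.

Theorem theorem5p1 (R : realType) :
  exists K : R, 0 < K /\
  forall (P : instance R -> Prop) (alpha_off alpha_on : instance R -> R),
    (exists Aoff : prog, offline_approx_algorithm P alpha_off Aoff) ->
    (exists Aon : prog, online_algorithm P alpha_on Aon) ->
    exists first second : prog,
      robust_approx_algorithm P
        (fun (I : instance R) (p : R) (q : nat) =>
           K * ((p + 1) * (q%:R + 1) * alpha_off I * alpha_on I))
        first second.
Proof.
exists 32; split; first by rewrite ltr0n.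
move=> P aoff aon [Aoff [koff Hoff]] [Aon [kon Hon]].
exists (First Aon), (Second Aoff).
(* The family [c1] ranges over all problems and all oracles, which fixes the exponent [k1] before
   the instance, [p] and [q] are given. *)
have size_gt0 (v : data R) : (0 < data_size v)%N by case: v.
pose c1 : ctx R := @Ctx R (problem R * (data R -> bool)) (fun xo => valid Aon kon xo.2 xo.1)
  (fun xo => data_size (input xo.1)) (fun xo => xo.2) (fun xo => size_gt0 _).
have [g1 [k1 hk1] first1] : pev (First Aon) (fun xo : c1 => input xo.1)
    (fun xo : c1 => fst_data (enc_best xo.1 (best_of xo.1))).
  apply: (@pev_first R Aon kon c1 (fun xo : c1 => xo.1)); split=> //.
  exact: pbd_sz.
pose k := (k1 + koff + 10)%N.
have bound_mono k' N : (0 < N)%N -> (k' <= k)%N -> (k' * N ^ k' <= k * N ^ k)%N.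
  by move=> N0 kk; rewrite leq_mul // leq_pexp2l.
exists k => I PI p M q w b lam Msys w0 lam1 O HO Omega inp.
have [f [f_comp f_sat f_mono f_cost]] := Hon I PI.
pose g r := f (rev r).
pose x := @Problem R I q w b lam M g.
have g_mono r e : g r \subset g (e :: r) by rewrite /g rev_cons.
have set_rev (r : seq 'I_(nreq I)) : [set i in rev r] = [set i in r].
  by apply/setP => i; rewrite !inE mem_rev.
have g_sat r : satisfies (g r) [set i in r] by rewrite -set_rev; exact: f_sat.
have g_comp r : bought g r <= aon I * opt [set i in r] by rewrite -set_rev; exact: f_cost.
have xv : valid Aon kon O x by split=> // r; exact: f_comp.
have [theta [best_eq _ _]] := best_thresholdP M w b g lam.
pose E0 := g (phases M w b g theta).
have off om : exists A, [/\ computes (@no_oracle R) koff Aoff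
      (Cons (enc_inst I) (Cons (enc_set R E0) (enc_set R om))) (enc_set R A),
    satisfies (E0 :|: A) om & set_cost A <= aoff I * opt_aug om E0].
  exact: Hoff.
have [A hA] := choice off.
exists E0, [ffun om => A om]; split.
- have [t ht lt] := first1 (x, O) xv.
  exists t; first by move: ht; rewrite /= /best_of /= best_eq.
  apply: leq_trans lt (leq_trans (hk1 (x, O) xv) _).
  by apply: bound_mono => //; rewrite /k; lia.
- move=> om _; rewrite ffunE; have [cA _ _] := hA om.
  have [t ht lt] := runs_second O (Cons (enc_knapsacks w b) (Num lam)) cA.
  exists t => //; apply: leq_trans lt _.
  set N := data_size _.
  apply: leq_trans (_ : (10 * N ^ koff + koff * N ^ koff <= _)%N).
    by rewrite leq_add2r leq_pmulr // expn_gt0 size_gt0.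
  by rewrite -mulnDl leq_mul //; [rewrite /k; lia | rewrite leq_pexp2l ?size_gt0 // /k; lia].
- by apply/forall_inP => om _; rewrite ffunE; have [] := hA om.
- apply: (robust_ratio Msys w0 lam1 _ g_sat g_mono g_comp best_eq).
    by move=> S X; have [B [_ ? ?]] := Hoff I PI S X; exists B.
  by move=> om _; rewrite ffunE; have [] := hA om.
Qed.
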